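(* Let $d\geq 1$ and let $\mathscr{A}\subseteq (0,1)^{d}$ be an analytic set. The following are equivalent: (a) $\mathscr{A}$ cannot be covered by an $F_{\sigma}$, purely unrectifiable subset of $\mathbb{R}^d$; (b) a typical $f\in\operatorname{Lip}_{1}([0,1]^{d})$ has points of differentiability in $\mathscr{A}$, i.e. the set of $f\in\operatorname{Lip}_1([0,1]^d)$ which are differentiable at some point of $\mathscr{A}$ is residual in $\operatorname{Lip}_1([0,1]^d)$.
   Context: $\operatorname{Lip}_{1}([0,1]^{d})$ denotes the set of all functions $f\colon[0,1]^d\to\mathbb{R}$ with Lipschitz constant at most $1$, viewed as a complete metric space with the supremum metric $\rho(f,g)=\|f-g\|_\infty$. A property holds for a typical $f\in\operatorname{Lip}_1([0,1]^d)$ if the set of $f$ with this property is residual (its complement is meagre). A Lipschitz curve is a Lipschitz map $\gamma\colon I\to\mathbb{R}^d$, $I\subseteq\mathbb{R}$ a closed interval, whose derivative is bounded away from zero in norm almost everywhere. A set $P\subseteq\mathbb{R}^d$ is purely unrectifiable if for every Lipschitz curve $\gamma\colon[0,1]\to\mathbb{R}^d$ the set $\gamma^{-1}(P)$ has Lebesgue measure zero. *)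

(* Defs.v *)
From HB Require Import structures.
From mathcomp Require Import all_boot all_order all_algebra.
From mathcomp Require Import all_classical all_reals all_analysis.
Unset Printing Implicit Defensive.
Import Order.TTheory GRing.Theory Num.Theory.
Import numFieldNormedType.Exports.
Local Open Scope classical_set_scope.
Local Open Scope ring_scope.

(* Points of R^d are row vectors 'rV[R]_d (library topology = Euclidean). *)

Definition enorm {R : realType} {d : nat} (v : 'rV[R]_d) : R :=
  Num.sqrt (\sum_(i < d) (v ord0 i) ^+ 2).

Definition ucube {R : realType} (d : nat) : set 'rV[R]_d :=
  [set x | forall i, 0 <= x ord0 i <= 1].
Definition open_cube {R : realType} (d : nat) : set 'rV[R]_d :=
  [set x | forall i, 0 < x ord0 i < 1].

(* Analytic sets: empty, or a continuous image of the Baire space nat^nat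
   (product topology of discrete nat; continuity spelled out). *)
Definition baire_continuous {R : realType} {d : nat}
  (g : (nat -> nat) -> 'rV[R]_d) : Prop :=
  forall (a : nat -> nat) (e : R), 0 < e -> exists n : nat,
    forall b : nat -> nat, (forall k, (k < n)%N -> b k = a k) ->
      enorm (g b - g a) < e.
Definition analytic {R : realType} {d : nat} (A : set 'rV[R]_d) : Prop :=
  A = set0 \/ exists g : (nat -> nat) -> 'rV[R]_d,
     baire_continuous g /\ A = range g.

Definition Fsigma {R : realType} {d : nat} (P : set 'rV[R]_d) : Prop :=
  exists F : nat -> set 'rV[R]_d, (forall n, closed (F n)) /\
    P = \bigcup_n F n.

Definition lipschitz_curve {R : realType} {d : nat} (gamma : R -> 'rV[R]_d)
  : Prop :=
  (exists K : R, forall s t, s \in `[0, 1] -> t \in `[0, 1] ->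
      enorm (gamma s - gamma t) <= K * `|s - t|) /\
  (exists c : R, 0 < c /\
     (@lebesgue_measure R).-negligible
       [set t | t \in `[0, 1] /\
          ~ (derivable gamma t 1 /\ c <= enorm (derive1 gamma t))]).

Definition purely_unrectifiable {R : realType} {d : nat} (P : set 'rV[R]_d)
  : Prop :=
  forall gamma : R -> 'rV[R]_d, lipschitz_curve gamma ->
    (@lebesgue_measure R).-negligible
      [set t | t \in `[0, 1] /\ P (gamma t)].

(* Lip_1([0,1]^d): a function on [0,1]^d is represented by its extension by
   zero outside the cube (a bijective encoding). *)
Definition Lip1 {R : realType} (d : nat) : set ('rV[R]_d -> R) :=
  [set f | (forall x y, ucube d x -> ucube d y ->
              `|f x - f y| <= enorm (x - y)) /\
           (forall x, ~ ucube d x -> f x = 0)].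

Definition sup_ball {R : realType} {d : nat} (f : 'rV[R]_d -> R) (r : R) :
  set ('rV[R]_d -> R) :=
  [set g | Lip1 d g /\ exists r', r' < r /\
     forall x, ucube d x -> `|f x - g x| <= r'].

Definition nowhere_dense_Lip1 {R : realType} {d : nat}
  (N : set ('rV[R]_d -> R)) : Prop :=
  forall f r, Lip1 d f -> 0 < r -> exists g s, Lip1 d g /\ 0 < s /\
    sup_ball g s `<=` sup_ball f r /\ sup_ball g s `&` N = set0.
Definition meagre_Lip1 {R : realType} {d : nat}
  (M : set ('rV[R]_d -> R)) : Prop :=
  exists N : nat -> set ('rV[R]_d -> R), (forall n, nowhere_dense_Lip1 (N n))
    /\ M `<=` \bigcup_n N n.
Definition residual_Lip1 {R : realType} {d : nat}
  (S : set ('rV[R]_d -> R)) : Prop :=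
  meagre_Lip1 (Lip1 d `\` S).

(* Main.v *)
Require Import Defs.
From HB Require Import structures.
From mathcomp Require Import all_boot all_order all_algebra.
From mathcomp Require Import all_classical all_reals all_analysis.
From mathcomp Require Import measurable_realfun.
From mathcomp Require Import ring lra.
Set Implicit Arguments.
Unset Strict Implicit.
Import Order.TTheory GRing.Theory Num.Theory.
Import numFieldNormedType.Exports.
Local Open Scope classical_set_scope.
Local Open Scope ring_scope.

(* If A is covered by closed purely unrectifiable sets F, then near any 1-Lipschitz
   function f there is one whose difference quotients in a fixed direction e are at
   least 1/2 at some small scale at all points of F: take the infimal cost of
   reaching a point by unit speed motions that earn a bonus when they move along -e
   close to F. The bonus is negligible, since otherwise a limit of such motions
   would be a Lipschitz curve spending positive measure of time in F. Together with
   the same statement for -f this makes differentiability at a point of A meagre.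

   If A is the image of the Baire space under g and is not coverable, prune the
   cylinders whose image is coverable. The closure of the image of each remaining
   cylinder meets some Lipschitz curve in positive measure, in directions that can
   be localised to a small cone around a unit vector e. Player II of the
   Banach-Mazur game replaces f by a function affine with gradient e on a small ball;
   any h uniformly close to it has slope nearly 1 along a nearly straight curve
   through that closure, and at a point p of the curve and the closure where this
   holds at all small scales, being 1-Lipschitz forces h to be nearly affine at p.
   Iterating with smaller cones and smaller cylinders, the gradients converge and the
   limit function is differentiable at the point of A encoded by the cylinders. *)

(** * Euclidean norm *)

(** Two obstacles shape the proof. A Lipschitz curve must have speed bounded below almost
    everywhere, which a limit of motions need not have. Sets of times are therefore cut down to
    pieces where the velocity lies in a narrow cone and the curve is nearly affine at one fixed
    scale; on such a piece the curve minus a linear motion has a small Lipschitz constant, and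
    extending this difference yields a nearly straight curve on the whole line. In the game, the
    good point of a stage depends on the function and lies only in a closure, so it is not the final
    point of differentiability. The two are close compared with the radius of the ball where the
    function was made affine, and this controls the final point at all scales between two stages.
    Since later moves shrink the cylinder, a direction is used only if every smaller unpruned
    cylinder still admits it. The bonus for motion along -e enters with weight 3/2: above 1, so that
    such motion earns, and below 2, so that long motions lose, because in a bounded set the
    displacement must be undone by free motion. *)

Section euclid.
Context {R : realType} {d : nat}.
Implicit Types (u v w : 'rV[R]_d) (a : R).

Definition dot u v : R := \sum_(i < d) u ord0 i * v ord0 i.

Lemma dotC u v : dot u v = dot v u.
Proof. by apply: eq_bigr => i _; rewrite mulrC. Qed.

Lemma dotDl u v w : dot (u + v) w = dot u w + dot v w.
Proof. by rewrite -big_split; apply: eq_bigr => i _; rewrite mxE mulrDl. Qed.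

Lemma dotZl a u v : dot (a *: u) v = a * dot u v.
Proof. by rewrite /dot mulr_sumr; apply: eq_bigr => i _; rewrite mxE mulrA. Qed.

Lemma dotNl u v : dot (- u) v = - dot u v.
Proof. by rewrite -scaleN1r dotZl mulN1r. Qed.

Lemma dotDr u v w : dot w (u + v) = dot w u + dot w v.
Proof. by rewrite dotC dotDl !(dotC w). Qed.

Lemma dotZr a u v : dot u (a *: v) = a * dot u v.
Proof. by rewrite dotC dotZl dotC. Qed.

Lemma dotNr u v : dot u (- v) = - dot u v.
Proof. by rewrite dotC dotNl dotC. Qed.

Lemma dotBl u v w : dot (u - v) w = dot u w - dot v w.
Proof. by rewrite dotDl dotNl. Qed.

Lemma dotBr u v w : dot w (u - v) = dot w u - dot w v.
Proof. by rewrite dotDr dotNr. Qed.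

Lemma dotvv_ge0 v : 0 <= dot v v.
Proof. by apply: sumr_ge0 => i _; rewrite -expr2 sqr_ge0. Qed.

Lemma enormE v : enorm v = Num.sqrt (dot v v).
Proof. by congr Num.sqrt; apply: eq_bigr => i _; rewrite expr2. Qed.

Lemma enorm_ge0 v : 0 <= enorm v.
Proof. exact: sqrtr_ge0. Qed.

Lemma sqr_enorm v : enorm v ^+ 2 = dot v v.
Proof. by rewrite enormE sqr_sqrtr // dotvv_ge0. Qed.

Lemma normr_coord_le_enorm v i : `|v ord0 i| <= enorm v.
Proof.
rewrite -sqrtr_sqr ler_wsqrtr // (bigD1 i) //= lerDl.
by apply: sumr_ge0 => j _; exact: sqr_ge0.
Qed.

Lemma enorm0 : enorm (0 : 'rV[R]_d) = 0.
Proof. by rewrite /enorm big1 ?sqrtr0 // => i _; rewrite mxE expr0n. Qed.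

Lemma enorm_basis (i : 'I_d) : enorm (\row_k (k == i)%:R : 'rV[R]_d) = 1.
Proof.
rewrite /enorm (bigD1 i)//= big1 ?addr0; first by rewrite mxE eqxx expr1n sqrtr1.
by move=> k ki; rewrite mxE (negbTE ki) expr0n.
Qed.

Lemma enorm_eq0 v : (enorm v == 0) = (v == 0).
Proof.
apply/eqP/eqP => [v0|->]; last exact: enorm0.
apply/rowP => i; rewrite mxE; apply/eqP; rewrite -normr_le0 -v0.
exact: normr_coord_le_enorm.
Qed.

Lemma enorm_gt0 v : (0 < enorm v) = (v != 0).
Proof. by rewrite lt_def enorm_ge0 andbT enorm_eq0. Qed.

Lemma enormZ a v : enorm (a *: v) = `|a| * enorm v.
Proof.
by rewrite enormE dotZl dotZr mulrA -expr2 sqrtrM ?sqr_ge0 // sqrtr_sqr -enormE.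
Qed.

Lemma enormN v : enorm (- v) = enorm v.
Proof. by rewrite -scaleN1r enormZ normrN1 mul1r. Qed.

Lemma enormC u v : enorm (u - v) = enorm (v - u).
Proof. by rewrite -enormN opprB. Qed.

Lemma dot_le_enorm u v : dot u v <= enorm u * enorm v.
Proof.
have [->|v0] := eqVneq v 0.
  by rewrite -(scale0r 0) dotZr enormZ normr0 !mul0r mulr0.
have B0 : 0 < dot v v by rewrite -sqr_enorm exprn_gt0 // enorm_gt0.
have := dotvv_ge0 (dot v v *: u - dot u v *: v).
rewrite dotBl !dotBr !dotZl !dotZr (dotC v u) => H.
have {}H : 0 <= dot v v * (dot u u * dot v v - dot u v ^+ 2) by lra.
rewrite pmulr_rge0 // subr_ge0 in H.
apply: (le_trans (ler_norm _)).
rewrite -(ler_pXn2r (ltn0Sn 1)) ?nnegrE ?mulr_ge0 ?enorm_ge0 //.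
by rewrite exprMn !sqr_enorm real_normK ?num_real.
Qed.

Lemma enormD u v : enorm (u + v) <= enorm u + enorm v.
Proof.
rewrite -(ler_pXn2r (ltn0Sn 1)) ?nnegrE ?addr_ge0 ?enorm_ge0 //.
rewrite sqrrD !sqr_enorm dotDl !dotDr (dotC v u).
by have := dot_le_enorm u v; lra.
Qed.

Lemma enormB u v : enorm (u - v) <= enorm u + enorm v.
Proof. by rewrite (le_trans (enormD _ _)) // enormN. Qed.

Lemma enorm_dist u v w : enorm (u - w) <= enorm (u - v) + enorm (v - w).
Proof. by rewrite -(subrKA v u) enormD. Qed.

Lemma lerB_enorm u v : enorm u - enorm v <= enorm (u - v).
Proof. by rewrite lerBlDr -{1}(subrK v u) enormD. Qed.

Lemma normr_dot_le_enorm u v : `|dot u v| <= enorm u * enorm v.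
Proof.
by rewrite ler_norml dot_le_enorm lerNl -dotNl -(enormN u) dot_le_enorm.
Qed.

Lemma normr_le_enorm v : `|v| <= enorm v.
Proof.
rewrite /Num.norm/= mx_normrE; apply/bigmax_leP; split; first exact: enorm_ge0.
by move=> x _; rewrite (ord1 x.1) normr_coord_le_enorm.
Qed.

Lemma coord_le_normr v i : `|v ord0 i| <= `|v|.
Proof.
rewrite [leRHS]/Num.norm/= mx_normrE.
exact: (le_bigmax _ (fun x : 'I_1 * 'I_d => `|v x.1 x.2|) (ord0, i)).
Qed.

Lemma enorm_le_normr v : enorm v <= d%:R * `|v|.
Proof.
rewrite -(ler_pXn2r (ltn0Sn 1)) ?nnegrE ?mulr_ge0 ?enorm_ge0 //.
rewrite sqr_enorm exprMn (@le_trans _ _ (\sum_(i < d) `|v| ^+ 2)) //.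
  apply: ler_sum => i _.
  rewrite -expr2 -[leLHS]real_normK ?num_real// ler_pXn2r ?nnegrE//.
  exact: coord_le_normr.
rewrite sumr_const card_ord -[leLHS]mulr_natl ler_wpM2r ?sqr_ge0//.
by rewrite expr2 -natrM ler_nat; case: d => // n; rewrite leq_pmulr.
Qed.

Lemma enorm_le_coord v (c : R) : (forall i, `|v ord0 i| <= c) -> 0 <= c ->
  enorm v <= d%:R * c.
Proof.
move=> vc c0; apply: (le_trans (enorm_le_normr v)); rewrite ler_wpM2l//.
rewrite /Num.norm/= mx_normrE; apply/bigmax_leP; split => // x _.
by rewrite (ord1 x.1) vc.
Qed.

Lemma nbhs_enormP (x : 'rV[R]_d) (P : set 'rV[R]_d) :
  nbhs x P <-> exists2 e : R, 0 < e & forall y, enorm (y - x) < e -> P y.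
Proof.
split.
  move=> /nbhs_ballP[e /= e0 xeP]; exists e => // y yxe; apply: xeP.
  by rewrite -ball_normE/= distrC (le_lt_trans (normr_le_enorm _)).
move=> [e e0 xeP]; apply/nbhs_ballP; exists (e / (d%:R + 1)) => /=.
  by rewrite divr_gt0// ltr_wpDl.
move=> y; rewrite -ball_normE/= distrC => yxe; apply: xeP.
rewrite (le_lt_trans (enorm_le_normr _))//.
rewrite ltr_pdivlMr ?ltr_wpDl// in yxe; rewrite (le_lt_trans _ yxe)//.
by rewrite mulrC ler_wpM2l// lerDl.
Qed.

Lemma closed_enorm (F : set 'rV[R]_d) x : closed F ->
  (forall e : R, 0 < e -> exists y, F y /\ enorm (y - x) < e) -> F x.
Proof.
move=> cF h; apply: cF => B /nbhs_enormP[e e0 xeB].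
by have [y [Fy yxe]] := h _ e0; exists y; split => //; exact: xeB.
Qed.

Lemma closure_enorm (F : set 'rV[R]_d) x : closure F x ->
  forall e : R, 0 < e -> exists y, F y /\ enorm (y - x) < e.
Proof.
move=> Fx e e0; have [|y [Fy yxe]] := Fx [set y | enorm (y - x) < e].
  by apply/nbhs_enormP; exists e.
by exists y.
Qed.

(** Bridge from a Euclidean first-order estimate to the differential of the library, whose little-o
    refers to the sup norm. *)
Lemma differentiable_enorm (f : 'rV[R]_d -> R) (x e : 'rV[R]_d) :
  (forall eps : R, 0 < eps -> exists2 rho : R, 0 < rho & forall v,
     enorm v <= rho -> `|f (x + v) - f x - dot e v| <= eps * enorm v) ->
  differentiable f x.
Proof.
move=> h.
pose L := (fun v => dot e v : R^o) : 'rV[R]_d -> R^o.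
have Ll : linear L by move=> a u v; rewrite /L dotDr dotZr.
pose Lm := GRing.isLinear.Build R _ _ _ L Ll.
pose LL : {linear 'rV[R]_d -> R^o} := HB.pack L Lm.
have cL : continuous LL.
  move=> y; apply/(@cvgrPdist_lt _ R^o _ (nbhs y) (nbhs_filter y)) => eps eps0.
  have e10 : 0 < enorm e + 1 by rewrite ltr_wpDl ?enorm_ge0.
  near=> z; rewrite -linearB/= /L.
  rewrite (le_lt_trans (normr_dot_le_enorm _ _))//.
  rewrite (@le_lt_trans _ _ ((enorm e + 1) * enorm (y - z)))//.
    by rewrite ler_wpM2r ?enorm_ge0// lerDl.
  rewrite mulrC -ltr_pdivlMr//.
  near: z; apply/nbhs_enormP; exists (eps / (enorm e + 1)).
    by rewrite divr_gt0.
  by move=> z; rewrite enormC.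
have : (f : _ -> R^o) \o shift x = cst (f x : R^o) + (LL : _ -> R^o)
    +o_ (0 : 'rV[R]_d) (id : 'rV[R]_d -> 'rV[R]_d).
  apply/eqaddoP => eps eps0.
  have dd : 0 < d%:R + 1 :> R by rewrite ltr_wpDl.
  have [|rho rho0 hr] := h (eps / (d%:R + 1)); first by rewrite divr_gt0.
  near=> v.
  rewrite !fctE/= [x in `|x|](_ : _ = f (x + v) - f x - dot e v); last first.
    by rewrite /L [v + x]addrC opprD addrA.
  have : enorm v <= rho.
    near: v; apply/nbhs_enormP; exists rho => // y.
    by rewrite subr0 => /ltW.
  move/hr => /le_trans; apply.
  rewrite -mulrA; apply: ler_wpM2l; first exact: ltW.
  rewrite ler_pdivrMl// (le_trans (enorm_le_normr v))//.
  by rewrite ler_wpM2r// lerDl.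
move=> fL; have dfL := diff_unique cL fL.
by apply/diff_locallyP; rewrite dfL; split.
Unshelve. all: by end_near. Qed.
End euclid.

(** * Increment estimates and nested intervals *)

Lemma derivable_eps (R : numFieldType) (V W : normedModType R) (f : V -> W) a v :
  derivable f a v -> forall eps : R, 0 < eps -> exists2 rho : R, 0 < rho &
  forall h : R, `|h| < rho ->
    `|f (a + h *: v) - f a - h *: 'D_v f a| <= eps * `|h|.
Proof.
move=> /derivable_nbhs /eqaddoP fav eps eps0.
have /nbhs_ballP[rho /= rho0 H] := fav _ eps0.
exists rho => // h hrho; have := H h.
rewrite -ball_normE/= sub0r normrN => /(_ hrho).
by rewrite !fctE/= [h *: v + a]addrC opprD addrA.
Qed.

Lemma ler_dist_split (R : realDomainType) (x y c : R) :
  `|x - y| <= c -> x <= y + c /\ y <= x + c.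
Proof. by rewrite ler_norml => /andP[h1 h2]; split; lra. Qed.

(** The intervals of centre [u n] and radius [s n] have every left end below every right end, so the
    supremum of the left ends lies in all of them. *)
Lemma nested_limit (R : realType) (u s : nat -> R) :
  (forall n m, u n - s n <= u m + s m) -> exists l, forall n, `|u n - l| <= s n.
Proof.
move=> us; exists (sup (range (fun n => u n - s n))) => n.
have ub : has_ubound (range (fun n => u n - s n)).
  by exists (u n + s n) => _ [m _ <-].
have h1 : u n - s n <= sup (range (fun n => u n - s n)).
  by apply: (ub_le_sup ub); exists n.
have h2 : sup (range (fun n => u n - s n)) <= u n + s n.
  by apply: ge_sup; [exists (u n - s n), n|move=> _ [m _ <-]].
by rewrite ler_norml; lra.
Qed.

(** * Record times, Lebesgue measure and Lipschitz extension *)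

Section records.
Context {R : realType}.
Implicit Types (phi : R -> R) (a b y L : R).
Local Notation mu := (@lebesgue_measure R).

(** The infimum of the times with [phi <= y]; the Lipschitz bound gives equality there from both
    sides. *)
Lemma first_passage phi L a b y : 0 < L ->
  (forall s t, `|phi s - phi t| <= L * `|s - t|) ->
  a <= b -> phi b <= y <= phi a ->
  exists t, [/\ a <= t <= b, phi t = y & forall s, a <= s <= t -> y <= phi s].
Proof.
move=> L0 phiL ab /andP[by_ ya].
pose A := [set t | a <= t <= b /\ phi t <= y].
have hA : has_inf A.
  split; first by exists b; split; rewrite ?lexx ?ab.
  by exists a => t [/andP[]].
pose t := inf A.
have at_ : a <= t by apply: lb_le_inf; [exact: hA.1|move=> s [/andP[]]].
have tb : t <= b by apply: (ge_inf hA.2); split; rewrite ?lexx ?ab.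
have below s : a <= s < t -> y < phi s.
  move=> /andP[as_ st]; rewrite ltNge; apply/negP => phis.
  have : t <= s by apply: (ge_inf hA.2); rewrite /A/= as_ (le_trans (ltW st)).
  by rewrite leNgt st.
have phity : phi t <= y.
  apply/ler_addgt0Pr => e e0.
  have [s [sab phis] st] := inf_adherent (divr_gt0 e0 L0) hA.
  have ts : t <= s by apply: (ge_inf hA.2).
  have [h _] := ler_dist_split (phiL t s).
  rewrite -/t in st; rewrite distrC ger0_norm ?subr_ge0// in h.
  have : L * (s - t) <= e by rewrite -ler_pdivlMl// mulrC; lra.
  lra.
have yphit : y <= phi t.
  move: at_; rewrite le_eqVlt => /predU1P[<-//|at_].
  apply/ler_addgt0Pr => e e0.
  pose s := Num.max a (t - e / L).
  have eL0 : 0 < e / L by rewrite divr_gt0.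
  have st : a <= s < t by rewrite le_max lexx /= gt_max at_ /=; lra.
  have [h _] := ler_dist_split (phiL s t).
  rewrite distrC ger0_norm ?subr_ge0 in h; last by case/andP: st => _ /ltW.
  have : L * (t - s) <= e.
    have : t - e / L <= s by rewrite le_max lexx orbT.
    by rewrite -ler_pdivlMl// mulrC; lra.
  by have := below _ st; lra.
exists t; split; first by rewrite at_ tb.
  by apply/eqP; rewrite eq_le phity yphit.
move=> s /andP[as_]; rewrite le_eqVlt => /predU1P[->//|st].
by apply/ltW/below; rewrite as_.
Qed.

(** Record lows. For [phi t = v t - k * t], a time of [[a, b]] fails to be one exactly when the
    slope of [v] from some earlier time exceeds [k]. *)
Definition forward_minima phi a b : set R :=
  [set t | a <= t <= b /\ forall s, a <= s <= t -> phi t <= phi s].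

Definition backward_maxima phi a b : set R :=
  [set t | a <= t <= b /\ forall s, t <= s <= b -> phi s <= phi t].

Lemma backward_maximaE phi a b :
  backward_maxima phi a b =
  -%R @^-1` forward_minima (fun t => - phi (- t)) (- b) (- a).
Proof.
apply/seteqP; split => t /= [/andP[at_ tb] h]; split.
- by rewrite !lerN2 at_ tb.
- move=> s /andP[bs st]; rewrite opprK lerN2; apply: h.
  by rewrite lerNr st lerNl bs.
- by rewrite !lerN2 in at_ tb; rewrite at_ tb.
- move=> s /andP[ts sb]; have := h (- s); rewrite !lerN2 ts sb !opprK.
  by apply.
Qed.

Lemma forward_minima_closed phi L a b : 0 < L ->
  (forall s t, `|phi s - phi t| <= L * `|s - t|) ->
  closed (forward_minima phi a b).
Proof.
move=> L0 phiL t clt.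
have near_pt e : 0 < e -> exists2 t', forward_minima phi a b t' & `|t - t'| < e.
  move=> e0; have [|t' [Gt' tt']] := clt (ball t e); first exact: nbhsx_ballx.
  by exists t'.
split.
  apply/andP; split; apply/ler_addgt0Pr => e e0;
    have [t' [/andP[at' t'b] _]] := near_pt _ e0; rewrite ltr_norml; lra.
move=> s /andP[as_ st]; apply/ler_addgt0Pr => e e0.
have [|t' [t'ab ht'] tt'] := near_pt (e / L); first by rewrite divr_gt0.
have [s't|t's] := leP s t'.
  have [h _] := ler_dist_split (phiL t t').
  have : L * `|t - t'| <= e by rewrite -ler_pdivlMl// mulrC ltW.
  have : phi t' <= phi s by apply: ht'; rewrite as_.
  lra.
have [h _] := ler_dist_split (phiL t s).
have : L * `|t - s| <= e.
  rewrite -ler_pdivlMl// mulrC (le_trans _ (ltW tt'))//.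
  by rewrite !ger0_norm; lra.
lra.
Qed.

Lemma backward_maxima_closed phi L a b : 0 < L ->
  (forall s t, `|phi s - phi t| <= L * `|s - t|) ->
  closed (backward_maxima phi a b).
Proof.
move=> L0 phiL; rewrite backward_maximaE.
apply: preimage_closed => [x _|].
  exact: opp_continuous.
apply: (@forward_minima_closed _ L) => // s t.
by rewrite opprK addrC (le_trans (phiL _ _))// opprK addrC.
Qed.

Lemma forward_minima_image phi L a b : 0 < L ->
  (forall s t, `|phi s - phi t| <= L * `|s - t|) -> a <= b ->
  `[phi b, phi a]%classic `<=` phi @` forward_minima phi a b.
Proof.
move=> L0 phiL ab y /=; rewrite in_itv/= => yab.
have [t [tab <- h]] := first_passage L0 phiL ab yab.
by exists t.
Qed.

Lemma backward_maxima_image phi L a b : 0 < L ->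
  (forall s t, `|phi s - phi t| <= L * `|s - t|) -> a <= b ->
  `[phi b, phi a]%classic `<=` phi @` backward_maxima phi a b.
Proof.
move=> L0 phiL ab y /=; rewrite in_itv/= => /andP[by_ ya].
have [| | |t tG tE] := @forward_minima_image (fun t => - phi (- t)) L (- b) (- a)
  L0 _ _ (- y).
- move=> s t.
  by rewrite opprK addrC (le_trans (phiL _ _))// opprK addrC.
- by rewrite lerN2.
- by rewrite /= in_itv/= !opprK !lerN2 by_ ya.
exists (- t); first by rewrite backward_maximaE/= opprK.
by apply: oppr_inj.
Qed.

(** A cover of [G] by intervals of total length close to [mu G] is mapped into intervals of [L]
    times these lengths. The Lipschitz bound is asked only on [G]: at record times it holds with a
    better constant than elsewhere. *)
Lemma lipschitz_image_measure (G : set R) phi L y0 y1 : 0 < L ->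
  measurable G -> (mu G < +oo)%E ->
  (forall s t, G s -> G t -> `|phi s - phi t| <= L * `|s - t|) ->
  `[y0, y1]%classic `<=` phi @` G ->
  ((y1 - y0)%:E <= L%:E * mu G)%E.
Proof.
move=> L0 mG Goo phiL sub.
have [y10|y01] := leP y1 y0.
  apply: (@le_trans _ _ 0%E); first by rewrite lee_fin subr_le0.
  by rewrite mule_ge0// lee_fin ltW.
apply/lee_addgt0Pr => e e0.
have eL0 : 0 < e / L by rewrite divr_gt0.
have /ereal_inf_lt[z [/= M covGM sMz zGe]] : (mu G < mu G + (e / L)%:E)%E.
  by rewrite lte_spaddre ?lte_fin// ge0_fin_numE.
have [mM GM] := covGM.
have M_itv n : exists ab, M n = `]ab.1, ab.2]%classic /\ ab.1 <= ab.2.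
  have [->|[ab ab12 ->]] := (ocitvP _).1 (mM n).
    by exists (0, 0); rewrite set_itv_ge// bnd_simp ltxx.
  by exists ab; split => //; exact: ltW.
have /choice[ab abE] := M_itv.
pose i n := inf (phi @` (G `&` M n)).
pose J n := `[i n, i n + L * ((ab n).2 - (ab n).1)]%classic.
have len_ge0 n : 0 <= L * ((ab n).2 - (ab n).1).
  by rewrite mulr_ge0 ?(ltW L0)// subr_ge0; case: (abE n).
have subJ : `[y0, y1]%classic `<=` \bigcup_n J n.
  move=> y /sub[t Gt <-]; have [n _ Mnt] := GM _ Gt; exists n => //.
  have dist s : (G `&` M n) s -> `|phi s - phi t| <= L * ((ab n).2 - (ab n).1).
    move=> [Gs Mns]; apply: (le_trans (phiL _ _ Gs Gt)).
    rewrite ler_wpM2l ?(ltW L0)//; move: Mns Mnt; rewrite (abE n).1/= !in_itv/=.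
    by move=> /andP[h1 h2] /andP[h3 h4]; rewrite ler_norml; lra.
  have lb : lbound (phi @` (G `&` M n)) (phi t - L * ((ab n).2 - (ab n).1)).
    by move=> _ [s /dist /ler_dist_split[h1 h2] <-]; lra.
  rewrite /J/= in_itv/=; apply/andP; split.
    by apply: ge_inf; [exists (phi t - L * ((ab n).2 - (ab n).1))|exists t].
  by rewrite -lerBlDr; apply: lb_le_inf => //; exists (phi t), t.
have mJ n : measurable (J n) by exact: measurable_itv.
have : (mu `[y0, y1]%classic <= \sum_(n <oo) mu (J n))%E.
  apply: measure_sigma_subadditive => //.
rewrite lebesgue_measure_itv/= lte_fin y01 EFinB => /le_trans; apply.
have wE n : wlength idfun (M n) = ((ab n).2 - (ab n).1)%:E.
  by have [-> ab12] := abE n; rewrite wlength_itv_bnd.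
have -> : (\sum_(n <oo) mu (J n) = L%:E * \sum_(n <oo) wlength idfun (M n))%E.
  rewrite -nneseriesZl; last first.
    by move=> n _; rewrite wE lee_fin subr_ge0; case: (abE n).
  apply: eq_eseriesr => n _.
  rewrite lebesgue_measure_itv/= lte_fin wE ltrDl -EFinB addrAC subrr add0r.
  by have := len_ge0 n; case: ltgtP => // h _; rewrite -EFinM// -h.
rewrite sMz (@le_trans _ _ (L%:E * (mu G + (e / L)%:E))%E)//.
  by rewrite lee_pmul2l ?lte_fin// ltW.
rewrite muleDr// ?fin_num_adde_defl// leeD2l// -EFinM lee_fin.
by rewrite mulrC divfK// gt_eqF.
Qed.

(** A rising sun inequality. On [G], [v] increases while [v t - k * t] decreases, so the latter is
    [k]-Lipschitz there; its image contains an interval of length [k * (b - a) - (v b - v a)], which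
    bounds [mu G] from below. *)
Lemma measure_monotone_section (G : set R) (v : R -> R) (k a b : R) : 0 < k ->
  a <= b -> closed G -> G `<=` `[a, b]%classic ->
  {homo v : s t / s <= t} ->
  (forall s t, G s -> G t -> s <= t -> v t - k * t <= v s - k * s) ->
  `[v b - k * b, v a - k * a]%classic `<=` (fun t => v t - k * t) @` G ->
  (mu (`[a, b] `\` G) <= ((v b - v a) / k)%:E)%E.
Proof.
move=> k0 ab cG Gab v_nd Gk Gim.
have mG : measurable G by exact: closed_measurable.
have abE : mu `[a, b]%classic = (b - a)%:E.
  rewrite lebesgue_measure_itv/= lte_fin; have [_|ba] := ltP; first by rewrite EFinB.
  by have -> : b - a = 0 by lra.
have Gfin : mu G \is a fin_num.
  rewrite ge0_fin_numE// (@le_lt_trans _ _ (mu `[a, b]%classic))//.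
    by apply: le_measure; rewrite ?inE.
  by rewrite abE ltry.
have Goo : (mu G < +oo)%E by rewrite -ge0_fin_numE.
have := lipschitz_image_measure k0 mG Goo _ Gim.
have -> : mu (`[a, b] `\` G) = (mu `[a, b]%classic - mu G)%E.
  rewrite measureD//= ?abE ?ltry//; congr (_ - mu _)%E.
  by rewrite setIC; apply/setIidPl.
rewrite abE -(fineK Gfin) -EFinB -EFinM !lee_fin ler_pdivlMr// => H.
suff : v a - k * a - (v b - k * b) <= k * fine (mu G) by lra.
apply: H => s t Gs Gt; wlog st : s t Gs Gt / s <= t.
  move=> h; have [st|/ltW ts] := leP s t; first exact: h.
  by rewrite distrC (distrC s); exact: h.
have := Gk _ _ Gs Gt st; have := v_nd _ _ st => h1 h2.
rewrite ger0_norm ?subr_ge0// distrC ger0_norm ?subr_ge0//.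
lra.
Qed.

(** Weak-type maximal inequality: the times counted are those from which [v] has slope above [k]
    towards some earlier time. The version below looks at later times. *)
Lemma measure_steep_backward (v : R -> R) (L k a b : R) : 0 < k -> 0 < L ->
  (forall s t, `|v s - v t| <= L * `|s - t|) -> a <= b ->
  {homo v : s t / s <= t} ->
  (mu (`[a, b] `\` forward_minima (fun t => v t - k * t)%R a b)
    <= ((v b - v a) / k)%:E)%E.
Proof.
move=> k0 L0 vL ab v_nd.
have phiL s t : `|v s - k * s - (v t - k * t)| <= (L + k) * `|s - t|.
  rewrite [x in `|x|](_ : _ = v s - v t - k * (s - t)); last by ring.
  by rewrite (le_trans (ler_normB _ _))// mulrDl lerD// normrM gtr0_norm.
have Lk0 : 0 < L + k by rewrite addr_gt0.
apply: measure_monotone_section => //.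
- exact: (@forward_minima_closed _ (L + k)).
- by move=> t [tab _]; rewrite /= in_itv.
- move=> s t [/andP[as_ _] _] [_ ht] st.
  by apply: ht; rewrite as_.
- exact: (forward_minima_image Lk0 phiL).
Qed.

Lemma measure_steep_forward (v : R -> R) (L k a b : R) : 0 < k -> 0 < L ->
  (forall s t, `|v s - v t| <= L * `|s - t|) -> a <= b ->
  {homo v : s t / s <= t} ->
  (mu (`[a, b] `\` backward_maxima (fun t => v t - k * t)%R a b)
    <= ((v b - v a) / k)%:E)%E.
Proof.
move=> k0 L0 vL ab v_nd.
have phiL s t : `|v s - k * s - (v t - k * t)| <= (L + k) * `|s - t|.
  rewrite [x in `|x|](_ : _ = v s - v t - k * (s - t)); last by ring.
  by rewrite (le_trans (ler_normB _ _))// mulrDl lerD// normrM gtr0_norm.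
have Lk0 : 0 < L + k by rewrite addr_gt0.
apply: measure_monotone_section => //.
- exact: (@backward_maxima_closed _ (L + k)).
- by move=> t [tab _]; rewrite /= in_itv.
- move=> s t [_ hs] [/andP[_ tb] _] st.
  by apply: hs; rewrite st.
- exact: (backward_maxima_image Lk0 phiL).
Qed.

Lemma density_interval (S : set R) (eta sigma : R) :
  measurable S -> ~ mu.-negligible S -> 0 < eta -> 0 < sigma ->
  exists x r : R, [/\ S x, 0 < r < sigma &
    (mu (`[(x - r)%R, (x + r)%R] `\` S) <= (eta * (2 * r))%:E)%E].
Proof.
move=> mS nS eta0 sigma0.
have [x [Sx dx]] : exists x, S x /\ (mu (S `&` ball x r) * (mu (ball x r))^-1
                      @[r --> 0^'+] --> (\1_S x)%:E)%E.
  apply: contrapT => h; apply: nS.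
  apply: negligibleS (lebesgue_density mS) => x Sx /= dx.
  by apply: h; exists x.
rewrite indicE mem_set//= in dx.
(* The closed interval returned has half the radius of the ball, so on the ball only half of the
   relative defect is allowed. *)
have h : ((1 - eta / 2)%:E < 1%:E)%E by rewrite lte_fin; lra.
have {}dx : \forall r \near 0^'+,
    ((1 - eta / 2)%:E < mu (S `&` ball x r) * (mu (ball x r))^-1)%E.
  exact: dx (open_ereal_gt' h).
near (0 : R)^'+ => r.
have r0 : 0 < r by near: r; exact: nbhs_right_gt.
have rs : r < sigma by near: r; exact: nbhs_right_lt.
have : ((1 - eta / 2)%:E < mu (S `&` ball x r) * (mu (ball x r))^-1)%E.
  by near: r.
have mB : measurable (ball x r) by exact: measurable_ball.
have Bfin : mu (S `&` ball x r) \is a fin_num.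
  rewrite ge0_fin_numE// (@le_lt_trans _ _ (mu (ball x r)))//.
    by apply: le_measure; rewrite ?inE//; exact: measurableI.
  by rewrite lebesgue_measure_ball ?ltry// ltW.
rewrite lebesgue_measure_ball ?(ltW r0)// -(fineK Bfin) inver gt_eqF ?mulrn_wgt0//.
rewrite -EFinM lte_fin ltr_pdivlMr ?mulrn_wgt0// => H.
exists x, (r / 2); split => //; first by lra.
apply: (@le_trans _ _ (mu (ball x r `\` S))).
  apply: le_measure; rewrite ?inE; [exact: measurableD|exact: measurableD|].
  move=> t [/=]; rewrite in_itv/= => tab nSt; split => //.
  by rewrite ball_itv/= in_itv/=; lra.
have Boo : (mu (ball x r) < +oo)%E.
  by rewrite lebesgue_measure_ball ?ltry// ltW.
have -> : mu (ball x r `\` S) = (mu (ball x r) - mu (S `&` ball x r))%E.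
  by rewrite measureD// setIC.
rewrite lebesgue_measure_ball ?(ltW r0)// -(fineK Bfin) -EFinB lee_fin.
by rewrite mulr2n in H *; lra.
Unshelve. all: by end_near. Qed.

(** The extension is the lower envelope of the cones [f s + L * |t - s|] with apex over [K]. *)
Lemma mcshane (K : set R) (f : R -> R) (L : R) : 0 <= L -> K !=set0 ->
  (forall s t, K s -> K t -> `|f s - f t| <= L * `|s - t|) ->
  exists g : R -> R, (forall s t, `|g s - g t| <= L * `|s - t|) /\
    forall t, K t -> g t = f t.
Proof.
move=> L0 [t0 Kt0] fL.
pose A t := [set f s + L * `|t - s| | s in K].
have lbA t : lbound (A t) (f t0 - L * `|t - t0|).
  move=> _ [s Ks <-]; have [h _] := ler_dist_split (fL _ _ Kt0 Ks).
  have : L * `|t0 - s| <= L * `|t - t0| + L * `|t - s|.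
    by rewrite -mulrDr ler_wpM2l// (distrC t t0) ler_distD.
  lra.
have hA t : has_inf (A t) by split; [exists (f t0 + L * `|t - t0|), t0|eexists].
have half s t : inf (A s) <= inf (A t) + L * `|s - t|.
  rewrite -lerBlDr; apply: lb_le_inf; first exact: (hA t).1.
  move=> _ [u Ku <-]; rewrite lerBlDr.
  apply: (@le_trans _ _ (f u + L * `|s - u|)).
    by apply: (ge_inf (hA s).2); exists u.
  by rewrite -addrA lerD2l -mulrDr ler_wpM2l// [leRHS]addrC ler_distD.
exists (fun t => inf (A t)); split.
  move=> s t; rewrite ler_norml; have := half s t; have := half t s.
  by rewrite (distrC t s); lra.
move=> t Kt; apply/eqP; rewrite eq_le; apply/andP; split.
  by apply: (ge_inf (hA t).2); exists t => //; rewrite subrr normr0 mulr0 addr0.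
apply: lb_le_inf; first exact: (hA t).1.
by move=> _ [s Ks <-]; have [h _] := ler_dist_split (fL _ _ Kt Ks).
Qed.
End records.

(** * Nearly straight pieces of Lipschitz curves *)

Section cone.
Context {R : realType} {d : nat}.
Implicit Types (E : set 'rV[R]_d) (gam : R -> 'rV[R]_d) (e : 'rV[R]_d).
Local Notation mu := (@lebesgue_measure R).

(** Extending coordinate by coordinate costs the factor [d]; it is absorbed later by taking cone
    widths with a factor [d + 1] in the denominator. *)
Lemma mcshane_vector (K : set R) (u : R -> 'rV[R]_d) (L : R) : 0 <= L ->
  K !=set0 ->
  (forall s t, K s -> K t -> enorm (u s - u t) <= L * `|s - t|) ->
  exists g : R -> 'rV[R]_d,
    (forall s t, enorm (g s - g t) <= d%:R * (L * `|s - t|)) /\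
    forall t, K t -> g t = u t.
Proof.
move=> L0 K0 uL.
have /choice[g gP] : forall i : 'I_d, exists g : R -> R,
    (forall s t, `|g s - g t| <= L * `|s - t|) /\
    forall t, K t -> g t = u t ord0 i.
  move=> i; apply: mcshane => // s t Ks Kt.
  apply: le_trans (uL _ _ Ks Kt).
  by have := normr_coord_le_enorm (u s - u t) i; rewrite !mxE.
exists (fun t => \row_i g i t); split.
  move=> s t; apply: enorm_le_coord; last by rewrite mulr_ge0.
  by move=> i; rewrite !mxE; exact: (gP i).1.
by move=> t Kt; apply/rowP => i; rewrite mxE (gP i).2.
Qed.

Definition cone_times E gam e (eps : R) : set R :=
  [set t | [/\ t \in `[0, 1], E (gam t), derivable gam t 1,
     0 < enorm (derive1 gam t) &
     enorm (derive1 gam t - enorm (derive1 gam t) *: e) <=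
       eps * enorm (derive1 gam t)]].

(* The index [p = (q, n, k)] consists of the speed [q], the scale [1 / (n + 1)] and
   the interval [[k / (n + 1), (k + 1) / (n + 1)]]. *)
Definition affine_times E gam e (eps : R) (p : rat * nat * nat) : set R :=
  [set t | [/\ t \in `[0, 1], E (gam t),
    p.2%:R <= t * p.1.2.+1%:R <= p.2%:R + 1 &
    0 < ratr p.1.1 :> R /\ forall s, s \in `[0, 1] ->
     `|s - t| <= p.1.2.+1%:R^-1 ->
     enorm (gam s - gam t - ((s - t) * ratr p.1.1) *: e) <=
       3 * eps * ratr p.1.1 * `|s - t|]].

(** Rational speeds make the decomposition countable. The constant 3 collects three errors of
    relative size [eps]: the remainder of the derivative, the deviation of its direction, and the
    rounding of the speed. *)
Lemma cone_times_cover E gam e (eps : R) : enorm e = 1 -> 0 < eps ->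
  cone_times E gam e eps `<=` \bigcup_p affine_times E gam e eps p.
Proof.
move=> e1 eps0 t [t01 Et dt]; set w := derive1 gam t; set l := enorm w => l0 wl.
have [q] : exists q : rat, ratr q \in `]l, l + eps * l[ :> bool.
  by apply: rat_in_itvoo; rewrite ltrDl mulr_gt0.
rewrite in_itv/= => /andP[lq ql].
have q0 : 0 < ratr q :> R by exact: lt_trans lq.
have dd : 0 < d%:R + 1 :> R by rewrite ltr_wpDl.
have [|rho rho0 hrho] := derivable_eps dt (eps := eps * ratr q / (d%:R + 1)).
  by rewrite divr_gt0// mulr_gt0.
have [n nrho] : exists n, n.+1%:R^-1 < rho.
  by have [n] := ltr_add_invr rho0; rewrite add0r; exists n.
exists (q, n, Num.truncn (t * n.+1%:R)) => //=; split => //=.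
  have /truncn_itv/andP[] : 0 <= t * n.+1%:R.
    by rewrite mulr_ge0//; move: t01; rewrite in_itv/= => /andP[].
  by rewrite -[X in _ < X]natr1 => -> /ltW ->.
split => // s s01 st.
have := hrho (s - t) (le_lt_trans st nrho).
rewrite -derive1E -/w /GRing.scale/= mulr1 subrKC => H.
have {}H : enorm (gam s - gam t - (s - t) *: w) <= eps * ratr q * `|s - t|.
  apply: (le_trans (enorm_le_normr _)).
  apply: (@le_trans _ _ ((d%:R + 1) * (eps * ratr q / (d%:R + 1) * `|s - t|))).
    by apply: ler_pM => //; rewrite lerDl.
  by rewrite mulrA (mulrC (d%:R + 1)) divfK// gt_eqF.
rewrite [X in enorm X](_ : _ = (gam s - gam t - (s - t) *: w) +
   ((s - t) *: (w - l *: e) + ((s - t) * (l - ratr q)) *: e)); last first.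
  by apply/rowP => i; rewrite !mxE; ring.
apply: (le_trans (enormD _ _)).
have H2 : enorm ((s - t) *: (w - l *: e)) <= eps * ratr q * `|s - t|.
  rewrite enormZ mulrC ler_wpM2r// (le_trans wl)// ler_wpM2l ?ltW//.
have H3 : enorm (((s - t) * (l - ratr q)) *: e) <= eps * ratr q * `|s - t|.
  rewrite enormZ e1 mulr1 normrM mulrC ler_wpM2r//.
  rewrite ler0_norm ?subr_le0 ?ltW// opprB.
  have : eps * l <= eps * ratr q by rewrite ler_wpM2l// ltW.
  lra.
have := enormD ((s - t) *: (w - l *: e)) (((s - t) * (l - ratr q)) *: e).
lra.
Qed.

(** Some affine piece is not negligible. Any two of its times are within the scale of the piece, so
    there [gam t - (t * q) *: e] has Lipschitz constant [3 * eps * q]. Its extension plus the linear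
    motion still visits [E] at all times of the piece. *)
Lemma cone_curve E gam e (eps : R) : enorm e = 1 -> 0 < eps ->
  ~ mu.-negligible (cone_times E gam e eps) ->
  exists q (c : R -> 'rV[R]_d), [/\ 0 < q,
    forall s t, enorm (c s - c t - ((s - t) * q) *: e) <=
      d%:R * (3 * eps * q * `|s - t|) &
    ~ mu.-negligible [set t | t \in `[0, 1] /\ E (c t)]].
Proof.
move=> e1 eps0 nnegl.
have [p np] : exists p, ~ mu.-negligible (affine_times E gam e eps p).
  apply: contrapT => /forallNP h; apply: nnegl.
  apply: negligibleS; first exact: (cone_times_cover e1 eps0).
  have -> : \bigcup_p affine_times E gam e eps p =
    \bigcup_n (if unpickle n is Some p then affine_times E gam e eps p else set0).
    apply/seteqP; split => [t [p _ Kp]|t [n _]].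
      by exists (pickle p); [exact: I|rewrite pickleK].
    by case: unpickle => // p Kp; exists p.
  apply: negligible_bigcup => n.
  case: unpickle => [p|]; last exact: negligible_set0.
  by have /contrapT := h p.
have q0 : 0 < ratr p.1.1 :> R /\ affine_times E gam e eps p !=set0.
  have [K0|/set0P[t Kt]] := eqVneq (affine_times E gam e eps p) set0.
    by exfalso; apply: np; rewrite K0; exact: negligible_set0.
  by split; [have [_ _ _ []] := Kt|exists t].
case: q0 => q0 K0.
pose q : R := ratr p.1.1.
pose u t := gam t - (t * q) *: e.
have [||g [gL gu]] := @mcshane_vector (affine_times E gam e eps p) u (3 * eps * q) _ K0.
- by apply: mulr_ge0; [apply: mulr_ge0 => //; exact: ltW|exact: ltW].
- move=> s t [s01 Es sj hs] [t01 Et tj [_ ht]].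
  rewrite /u [X in enorm X](_ : _ = gam s - gam t - ((s - t) * q) *: e).
    apply: ht => //.
    have n0 : 0 < p.1.2.+1%:R :> R by rewrite ltr0n.
    rewrite -[leRHS]mul1r ler_pdivlMr//.
    rewrite -[X in _ * X](gtr0_norm n0) -normrM mulrBl ler_norml; lra.
  by apply/rowP => i; rewrite !mxE; ring.
exists q, (fun t => g t + (t * q) *: e); split => //.
  move=> s t.
  rewrite [X in enorm X](_ : _ = g s - g t); first exact: gL.
  by apply/rowP => i; rewrite !mxE; ring.
apply: contra_not np; apply: negligibleS => t Kt; split; first by case: Kt.
by rewrite gu// /u subrK; case: Kt.
Qed.
End cone.

(** * Rademacher's theorem for curves *)

Section rademacher.
Context {R : realType}.
Local Notation mu := (@lebesgue_measure R).

Lemma lipschitz_stieltjes_le (g : cumulative R R) (L : R) (A : set R) : 0 < L ->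
  (forall s t, `|g s - g t| <= L * `|s - t|) ->
  (lebesgue_stieltjes_measure g A <= L%:E * mu A)%E.
Proof.
move=> L0 gL.
have [muA|muA] := eqVneq (mu A) (+oo)%E.
  by rewrite muA gt0_muley ?lte_fin// leey.
have Afin : mu A \is a fin_num by rewrite ge0_fin_numE// ltey.
apply/lee_addgt0Pr => e e0.
have eL0 : 0 < e / L by rewrite divr_gt0.
have /ereal_inf_lt[z [/= M covGM sMz zGe]] : (mu A < mu A + (e / L)%:E)%E.
  by rewrite lte_spaddre ?lte_fin.
have [mM GM] := covGM.
apply: (@le_trans _ _ (\sum_(k <oo) wlength g (M k))%E).
  by apply: ereal_inf_lbound; exists M.
apply: (@le_trans _ _ (L%:E * \sum_(k <oo) wlength idfun (M k))%E); last first.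
  rewrite sMz (@le_trans _ _ (L%:E * (mu A + (e / L)%:E))%E)//.
    by rewrite lee_pmul2l ?lte_fin// ltW.
  rewrite muleDr// ?fin_num_adde_defl// leeD2l// -EFinM lee_fin.
  by rewrite mulrC divfK// gt_eqF.
rewrite -nneseriesZl; last by move=> n _; exact: wlength_ge0.
apply: lee_nneseries => [n _ _|n _].
  exact: wlength_ge0.
have [->|[ab ab12 ->]] := (ocitvP _).1 (mM n).
  by rewrite !wlength0 mule0.
have ab12' := ltW ab12.
rewrite !wlength_itv_bnd// -EFinM lee_fin/=.
have := gL ab.2 ab.1; rewrite ler_norml => /andP[_].
by rewrite gtr0_norm ?subr_gt0.
Qed.

Lemma derivable_locally_shift (F g : R -> R) (x k : R) : derivable F x 1 ->
  (forall y, `|y - x| < 1 -> g y = F y + k) -> derivable g x 1.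
Proof.
move=> dF gF.
have := derivableD dF (derivable_cst k x 1).
apply: near_eq_derivable; apply/nbhs_ballP; exists 1 => //= y.
by rewrite /ball/= distrC => /gF ->.
Qed.

(** The Stieltjes measure of [g] is at most [L] times Lebesgue measure, so it has a density by
    Radon-Nikodym. Up to a constant [g] is the integral of that density, and Lebesgue
    differentiation applies. *)
Lemma lipschitz_monotone_ae_derivable (g : R -> R) (L : R) : 0 < L ->
  {homo g : s t / s <= t} ->
  (forall s t, `|g s - g t| <= L * `|s - t|) ->
  mu.-negligible [set t | t \in `[0, 1] /\ ~ derivable g t 1].
Proof.
move=> L0 g_nd gL.
have gc : continuous g.
  move=> x; apply/(@cvgrPdist_lt _ R^o) => e e0; near=> y.
  apply: (le_lt_trans (gL _ _)); rewrite -ltr_pdivlMl// mulrC.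
  near: y; apply/nbhs_ballP; exists (e / L); first by rewrite /= divr_gt0.
  by move=> y.
pose gm := isCumulative.Build R _ R g g_nd (right_continuousW gc).
pose G : cumulative R R := HB.pack g gm.
(* A bounded interval makes the restricted measure finite, and the margin keeps a neighbourhood of
   every point of [[0, 1]] inside. *)
pose D : set (measurableTypeR R) := `]-1, 2]%classic.
have mD : measurable D by exact: measurable_itv.
pose nu := mrestr (lebesgue_stieltjes_measure G) mD.
have nuD : lebesgue_stieltjes_measure G D = (g 2 - g (-1))%:E.
  rewrite [LHS](_ : _ = wlength G D); last first.
    by apply: (measurable_mu_extE (wlength G)); exact: is_ocitv.
  by rewrite wlength_itv_bnd//; lra.
have nu_fin : fin_num_fun nu.
  move=> A mA; rewrite ge0_fin_numE// (@le_lt_trans _ _ (g 2 - g (-1))%:E) ?ltry//.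
  rewrite -nuD; apply: le_measure; rewrite ?inE//; exact: measurableI.
pose nuf := Measure_isFinite.Build _ _ _ nu nu_fin.
pose NU : {finite_measure set (measurableTypeR R) -> \bar R} := HB.pack nu nuf.
have numu : NU `<< mu.
  apply/null_content_dominatesP => A mA muA0.
  apply/eqP; rewrite eq_le measure_ge0 andbT.
  apply: (@le_trans _ _ (lebesgue_stieltjes_measure G A)).
    by apply: le_measure; rewrite ?inE//; exact: measurableI.
  have GL : forall s t, `|G s - G t| <= L * `|s - t| := gL.
  have muA0' : mu A = 0%E := muA0.
  by rewrite (le_trans (@lipschitz_stieltjes_le G L A L0 GL))// muA0' mule0.
have [f [f0 ffin fint fE]] := radon_nikodym_sigma_finite numu.
pose f' := fine \o f.
have f'E : EFin \o f' = f by apply/funext => x /=; rewrite fineK.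
have int_f' : mu.-integrable setT (EFin \o f') by rewrite f'E.
pose F y := (\int[mu]_(t in `]-1, y]) (f' t))%R.
have FE y : -1 <= y <= 2 -> F y = g y - g (-1).
  move=> /andP[y1 y2]; rewrite /F /Rintegral.
  rewrite [X in fine X](_ : _ = NU `]-1, y]%classic); last first.
    rewrite fE; last exact: measurable_itv.
    by apply: eq_integral => t _; rewrite /f'/= fineK.
  rewrite [NU _](_ : _ = lebesgue_stieltjes_measure G `]-1, y]%classic).
    rewrite [lebesgue_stieltjes_measure G _](_ : _ = wlength G `]-1, y]%classic).
      by rewrite wlength_itv_bnd.
    by apply: (measurable_mu_extE (wlength G)); exact: is_ocitv.
  congr (lebesgue_stieltjes_measure G _); apply/setIidPl => t /=.
  by rewrite /D/= !in_itv/= => /andP[-> ty]; exact: le_trans ty y2.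
have := lebesgue_differentiation (integrable_locally_restrict measurableT int_f').
rewrite patch_setT; apply: negligibleS => x [x01 ndx] /= xf; apply: ndx.
move: x01; rewrite in_itv/= => /andP[x0 x1].
have [|||dF _] := @FTC1_lebesgue_pt R f' (BRight (-1)) x 2 _ _ _ xf.
- by lra.
- exact: integrableS int_f'.
- by rewrite lte_fin (lt_le_trans _ x0)// ltrN10.
apply: (derivable_locally_shift (k := g (-1)) dF) => y yx.
by rewrite -/(F y) FE ?subrK//; move: yx; rewrite ltr_norml; lra.
Unshelve. all: by end_near. Qed.

Lemma derivable_mull (L t : R) : derivable (fun t : R => L * t) t 1.
Proof.
rewrite (_ : (fun t => L * t) = cst L * id); last by apply/funext.
by apply: derivableM; [exact: derivable_cst|exact: derivable_id].
Qed.

(** Adding [L * t] makes the function monotone without affecting derivability. *)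
Lemma lipschitz_ae_derivable (h : R -> R) (L : R) : 0 < L ->
  (forall s t, `|h s - h t| <= L * `|s - t|) ->
  mu.-negligible [set t | t \in `[0, 1] /\ ~ derivable h t 1].
Proof.
move=> L0 hL.
have H : mu.-negligible
    [set t | t \in `[0, 1] /\ ~ derivable (fun t => h t + L * t) t 1].
  apply: (@lipschitz_monotone_ae_derivable _ (2 * L)).
  - by rewrite mulr_gt0.
  - move=> s t st; have [+ _] := ler_dist_split (hL s t).
    by rewrite distrC ger0_norm ?subr_ge0//; lra.
  - move=> s t.
    rewrite [x in `|x|](_ : _ = h s - h t + L * (s - t)); last by ring.
    rewrite (le_trans (ler_normD _ _))// -mulrA mulrDl mul1r lerD//.
    by rewrite normrM gtr0_norm.
apply: negligibleS H => t [t01 ndt]; split; [exact: t01|move=> dt; apply: ndt].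
have : derivable (fun t => (h t + L * t) - L * t) t 1.
  apply: (@derivableB _ _ _ (fun t => h t + L * t) (fun t => L * t)); first exact: dt.
  exact: derivable_mull.
by under eq_fun do rewrite addrK.
Qed.

Lemma lipschitz_curve_ae_derivable d (c : R -> 'rV[R]_d) (L : R) : 0 < L ->
  (forall s t, enorm (c s - c t) <= L * `|s - t|) ->
  mu.-negligible [set t | t \in `[0, 1] /\ ~ derivable c t 1].
Proof.
move=> L0 cL.
pose N (n : nat) : set R := [set t | t \in `[0, 1] /\
  exists2 i : 'I_d, i = n :> nat & ~ derivable (fun t => c t ord0 i) t 1].
suff : mu.-negligible (\bigcup_n N n).
  apply: negligibleS => t [t01 /derivable_mxP]; apply: contra_notP => hN i j.
  rewrite (ord1 i); apply: contrapT => nd; apply: hN.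
  by exists j => //; split => //; exists j.
apply: negligible_bigcup => n.
have [nd|dn] := ltnP n d; last first.
  apply: negligibleS (negligible_set0 _) => t [_ [i iE]].
  by move: dn; rewrite -iE leqNgt ltn_ord.
apply: negligibleS (@lipschitz_ae_derivable (fun t => c t ord0 (Ordinal nd)) L L0 _).
  move=> t [t01 [i iE]]; rewrite (_ : i = Ordinal nd)//; exact: val_inj.
move=> s t; apply: le_trans (cL s t).
by have := normr_coord_le_enorm (c s - c t) (Ordinal nd); rewrite !mxE.
Qed.
End rademacher.

(** * Curves meeting purely unrectifiable sets *)

Section nets.
Context {R : realType} {d : nat}.

(** Cut [[-1, 1]^d] into cells of side [1 / (n + 1)] and keep one unit vector per cell that contains
    one, so that the net consists of unit vectors. *)
Lemma unit_net (eps : R) : 0 < eps -> exists s : seq 'rV[R]_d,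
  (forall e, e \in s -> enorm e = 1) /\
  forall w, enorm w = 1 -> exists2 e, e \in s & enorm (w - e) <= eps.
Proof.
move=> eps0.
have [n ne] := ltr_add_invr (divr_gt0 eps0 (ltr_wpDl (ler0n R d) ltr01)).
rewrite add0r in ne.
pose box (w : 'rV[R]_d) : {ffun 'I_d -> 'I_(n.+1).*2.+1} :=
  [ffun i => inord (Num.truncn ((w ord0 i + 1) * n.+1%:R))].
have /choice[rep repP] : forall b, exists w : 'rV[R]_d,
    (exists2 w', enorm w' = 1 & box w' = b) -> enorm w = 1 /\ box w = b.
  move=> b; have [[w w1 wb]|h] := pselect (exists2 w', enorm w' = 1 & box w' = b).
    by exists w.
  by exists 0.
exists [seq rep b | b <- enum {: {ffun 'I_d -> 'I_(n.+1).*2.+1}} &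
          `[< exists2 w', enorm w' = 1 & box w' = b >]].
split.
  move=> e /mapP[b]; rewrite mem_filter => /andP[/asboolP hb _] ->.
  by case: (repP b hb).
move=> w w1; have hw : exists2 w', enorm w' = 1 & box w' = box w by exists w.
exists (rep (box w)).
  by apply/map_f; rewrite mem_filter mem_enum andbT; apply/asboolP.
have [r1 rb] := repP _ hw.
have n0 : 0 < n.+1%:R :> R by rewrite ltr0n.
(* The truncations stay in the range of the finite type, so [inord] does not fall back to its
   default and equal cells mean equal truncations. *)
have key (v : 'rV[R]_d) i : enorm v = 1 ->
   let k := Num.truncn ((v ord0 i + 1) * n.+1%:R) in
   (k < (n.+1).*2.+1)%N /\ k%:R <= (v ord0 i + 1) * n.+1%:R <= k%:R + 1.
  move=> v1 k; have := normr_coord_le_enorm v i; rewrite v1 ler_norml => /andP[h1 h2].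
  have h0 : 0 <= (v ord0 i + 1) * n.+1%:R by rewrite mulr_ge0//; lra.
  have /andP[k1 k2] := truncn_itv h0; rewrite -/k in k1 k2.
  rewrite k1 /= -[X in _ < X]natr1 in k2 *; rewrite ltW//; split => //.
  rewrite ltnS -(ler_nat R) (le_trans k1)// -mul2n natrM ler_wpM2r//; lra.
apply: (@le_trans _ _ (d%:R * n.+1%:R^-1)).
  apply: enorm_le_coord; last by rewrite invr_ge0.
  move=> i; rewrite !mxE.
  have := congr1 (fun b : {ffun 'I_d -> 'I_(n.+1).*2.+1} => val (b i)) rb.
  rewrite !ffunE/=.
  have [k1 k2] := key _ i w1; have [k3 k4] := key _ i r1.
  rewrite !inordK// => kk; rewrite kk in k4.
  rewrite -[leRHS]mul1r ler_pdivlMr//.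
  rewrite -[X in _ * X](gtr0_norm n0) -normrM mulrBl ler_norml; lra.
rewrite (@le_trans _ _ ((d%:R + 1) * n.+1%:R^-1))//.
  by rewrite ler_wpM2r ?invr_ge0// lerDl.
by rewrite mulrC -ler_pdivlMr ?ltr_wpDl// ltW.
Qed.

End nets.

Section curves.
Context {R : realType}.
Local Notation mu := (@lebesgue_measure R).

(** A lower bound along times accumulating at [t] suffices once the derivative exists; a set of
    times without isolated points supplies just that. *)
Lemma derive1_enorm_ge d (c : R -> 'rV[R]_d) (t m : R) : derivable c t 1 ->
  (forall r, 0 < r -> exists s, [/\ s != t, `|s - t| < r &
     m * `|s - t| <= enorm (c s - c t)]) ->
  m <= enorm (derive1 c t).
Proof.
move=> dc acc; apply/ler_addgt0Pr => e e0.
have dd : 0 < d%:R + 1 :> R by rewrite ltr_wpDl.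
have [r r0 hr] := derivable_eps dc (divr_gt0 e0 dd).
have [s [st sr ms]] := acc _ r0.
have := hr _ sr; rewrite -derive1E /GRing.scale/= mulr1 subrKC => H.
have st0 : 0 < `|s - t| by rewrite normr_gt0 subr_eq0.
have {}H : enorm (c s - c t - (s - t) *: derive1 c t) <= e * `|s - t|.
  apply: (le_trans (enorm_le_normr _)).
  apply: (@le_trans _ _ ((d%:R + 1) * (e / (d%:R + 1) * `|s - t|))).
    by apply: ler_pM => //; rewrite lerDl.
  by rewrite mulrA (mulrC (d%:R + 1)) divfK// gt_eqF.
have := lerB_enorm (c s - c t) ((s - t) *: derive1 c t); rewrite enormZ => H2.
rewrite -(ler_pM2r st0) mulrDl; lra.
Qed.

(** Near an isolated point the set reduces to that point, so its density there is 0 instead of 1. *)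
Lemma isolated_negligible (K : set R) : measurable K ->
  mu.-negligible [set t | K t /\ exists2 r, 0 < r &
    forall s, K s -> `|s - t| < r -> s = t].
Proof.
move=> mK.
apply: negligibleS (lebesgue_density mK) => x [Kx [r r0 iso]] /= dx.
rewrite indicE mem_set//= in dx.
have h : ((2^-1)%:E < 1%:E :> \bar R)%E by rewrite lte_fin; lra.
have {}dx : \forall r \near 0^'+,
    ((2^-1)%:E < mu (K `&` ball x r) * (mu (ball x r))^-1)%E.
  exact: dx (open_ereal_gt' h).
near (0 : R)^'+ => u.
have : ((2^-1)%:E < mu (K `&` ball x u) * (mu (ball x u))^-1)%E by near: u.
have u0 : 0 < u by near: u; exact: nbhs_right_gt.
have ur : u < r by near: u; exact: nbhs_right_lt.
have -> : K `&` ball x u = [set x].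
  apply/seteqP; split => [y [Ky xy]|_ ->]; last first.
    by split => //; exact: ballxx.
  by apply: iso => //; rewrite distrC (lt_trans xy).
by rewrite lebesgue_measure_set1 mul0e lte_fin; lra.
Unshelve. all: by end_near. Qed.

Lemma nonnegligible_cone d (E : set 'rV[R]_d) (c : R -> 'rV[R]_d) (S : set R)
    (eps : R) (net : seq 'rV[R]_d) :
  (forall w, enorm w = 1 -> exists2 e, e \in net & enorm (w - e) <= eps) ->
  ~ mu.-negligible S ->
  (forall t, S t -> [/\ t \in `[0, 1], E (c t), derivable c t 1 &
     0 < enorm (derive1 c t)]) ->
  exists2 e, e \in net & ~ mu.-negligible (S `&` cone_times E c e eps).
Proof.
move=> netP nS hS; apply: contrapT => h; apply: nS.
pose N n := if (n < size net)%N then S `&` cone_times E c (nth 0 net n) eps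
  else set0.
suff : mu.-negligible (\bigcup_n N n).
  apply: negligibleS => t St; have [t01 Et dt w0] := hS _ St.
  set w := derive1 c t in w0 *.
  have [|e es we] := netP ((enorm w)^-1 *: w).
    by rewrite enormZ ger0_norm ?invr_ge0 ?enorm_ge0// mulVf// gt_eqF.
  exists (index e net) => //; rewrite /N index_mem es nth_index//; split => //.
  split => //; rewrite -/w.
  rewrite [X in enorm X](_ : _ = enorm w *: ((enorm w)^-1 *: w - e)); last first.
    by rewrite scalerBr scalerA divff ?scale1r// gt_eqF.
  by rewrite enormZ ger0_norm ?enorm_ge0// mulrC ler_wpM2r ?enorm_ge0.
apply: negligible_bigcup => n; rewrite /N; case: ifPn => [ns|_]; last first.
  exact: negligible_set0.
apply: contrapT => nn; apply: h; exists (nth 0 net n) => //.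
exact: mem_nth.
Qed.

(** The width makes the deviation of the nearly straight curve from a motion of speed [q] at most
    [q / 2]. The extended curve then expands by at least [q / 2] everywhere, which makes it an
    admissible test curve. *)
Lemma cone_times_not_unrectifiable d (E : set 'rV[R]_d) (c : R -> 'rV[R]_d) e :
  enorm e = 1 ->
  ~ mu.-negligible (cone_times E c e (6 * (d%:R + 1))^-1) ->
  ~ purely_unrectifiable E.
Proof.
move=> e1 nn pu.
have dd : 0 < d%:R + 1 :> R by rewrite ltr_wpDl.
have eps0 : 0 < (6 * (d%:R + 1))^-1 :> R by rewrite invr_gt0 mulr_gt0.
have [q [g [q0 gq ng]]] := cone_curve e1 eps0 nn.
apply: ng; apply: pu.
have bnd s t : enorm (g s - g t - ((s - t) * q) *: e) <= q / 2 * `|s - t|.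
  apply: (le_trans (gq s t)).
  rewrite [leLHS](_ : _ = (d%:R / (d%:R + 1)) * (q / 2 * `|s - t|)); last first.
    by field; rewrite gt_eqF.
  rewrite ler_piMl ?mulr_ge0 ?divr_ge0 ?(ltW q0)//.
  by rewrite ler_pdivrMr// mul1r lerDl.
have up s t : enorm (g s - g t) <= 2 * q * `|s - t|.
  have := lerB_enorm (g s - g t) (((s - t) * q) *: e).
  rewrite enormZ e1 mulr1 normrM (gtr0_norm q0).
  have := bnd s t; have : 0 <= q * `|s - t| by rewrite mulr_ge0// ltW.
  lra.
have low s t : q / 2 * `|s - t| <= enorm (g s - g t).
  have := lerB_enorm (((s - t) * q) *: e) (g s - g t).
  rewrite enormZ e1 mulr1 normrM (gtr0_norm q0) (enormC (_ *: e)).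
  have := bnd s t.
  lra.
split.
  by exists (2 * q) => s t _ _.
exists (q / 2); split; first by rewrite divr_gt0.
have q20 : 0 < 2 * q by rewrite mulr_gt0.
apply: negligibleS (lipschitz_curve_ae_derivable q20 up) => t [t01 nd].
split; first exact: t01.
move=> dg; apply: nd; split => //.
apply: derive1_enorm_ge => // r r0.
exists (t + r / 2); split.
- by rewrite -subr_eq0 addrAC subrr add0r mulf_neq0// ?invr_eq0// gt_eqF.
- by rewrite addrAC subrr add0r gtr0_norm ?divr_gt0//; lra.
- exact: low.
Qed.

(* At the record times of [phi - k t] the curve [w] is expanding, hence has nonzero
   derivative almost everywhere, and it lies in [F]; if [phi] increased these times
   would have positive measure. *)
Lemma unrectifiable_gain d (F : set 'rV[R]_d) (w : R -> 'rV[R]_d) (phi : R -> R)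
    (T L : R) : closed F -> purely_unrectifiable F -> 0 < T -> 0 < L ->
  (forall s t, enorm (w s - w t) <= `|s - t|) ->
  (forall s t, `|phi s - phi t| <= L * `|s - t|) ->
  (forall s t, s <= t -> phi t - phi s <= 2 * enorm (w t - w s)) ->
  (forall t, 0 < t <= T -> ~ F (w t) -> exists s, 0 <= s < t /\ phi t <= phi s) ->
  phi T <= phi 0.
Proof.
move=> cF pu T0 L0 wL phiL phiw phiF; rewrite leNgt; apply/negP => gain.
(* Half the average slope: [phi t - k * t] still gains [(phi T - phi 0) / 2], while [phi] grows at
   rate at least [k] between record times. *)
pose k := (phi T - phi 0) / (2 * T).
have T2 : 0 < 2 * T by rewrite mulr_gt0.
have k0 : 0 < k by rewrite divr_gt0// subr_gt0.
have kT : k * T = (phi T - phi 0) / 2 by rewrite /k; field; rewrite gt_eqF.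
pose f t := k * (T * t) - phi (T * t).
have fL s t : `|f s - f t| <= ((k + L) * T) * `|s - t|.
  rewrite [x in `|x|](_ : _ = k * T * (s - t) - (phi (T * s) - phi (T * t))).
    apply: (le_trans (ler_normB _ _)); rewrite mulrDl mulrDl lerD//.
      by rewrite normrM gtr0_norm// mulr_gt0.
    apply: (le_trans (phiL _ _)).
    by rewrite -mulrBr normrM (gtr0_norm T0) mulrA.
  by rewrite /f; ring.
have Lp : 0 < (k + L) * T by rewrite mulr_gt0// addr_gt0.
pose K := forward_minima f 0 1.
have cK : closed K := forward_minima_closed Lp fL.
have mK : measurable K by exact: closed_measurable.
have nK : ~ mu.-negligible K.
  move=> [N [mN N0 KN]].
  have K0 : mu K = 0%E.
    apply/eqP; rewrite eq_le measure_ge0 andbT -N0.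
    by apply: le_measure; rewrite ?inE.
  have Kf : (mu K < +oo)%E by rewrite K0 ltry.
  have := lipschitz_image_measure Lp mK Kf (fun s t _ _ => fL s t)
    (forward_minima_image Lp fL ler01).
  rewrite K0 mule0 lee_fin /f !mulr1 !mulr0; lra.
pose c t := w (T * t).
have cL s t : enorm (c s - c t) <= T * `|s - t|.
  by apply: (le_trans (wL _ _)); rewrite -mulrBr normrM gtr0_norm.
have clow s t : K s -> K t -> k * T / 2 * `|s - t| <= enorm (c s - c t).
  wlog st : s t / s <= t.
    move=> H Ks Kt; have [/H|/ltW/H] := leP s t; first exact.
    by rewrite (distrC s) enormC; exact.
  move=> [/andP[s0 _] _] [_ /(_ s)]; rewrite s0 st => /(_ isT).
  rewrite distrC enormC ger0_norm ?subr_ge0// /f => ft.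
  have := phiw (T * s) (T * t); rewrite ler_pM2l// => /(_ st).
  rewrite -/(c s) -/(c t); lra.
have KF t : K t -> 0 < t -> F (c t).
  move=> [/andP[_ t1] ht] t0; apply: contrapT => nF.
  have [|s [/andP[s0 st] phis]] := phiF (T * t) _ nF.
    by rewrite mulr_gt0//= -[leRHS]mulr1 ler_pM2l.
  have := ht (s / T); rewrite divr_ge0 ?(ltW T0)//= ler_pdivrMr// mulrC (ltW st).
  have TsT : T * (s / T) = s by rewrite mulrC divfK// gt_eqF.
  move=> /(_ isT); rewrite /f TsT.
  have : k * s < k * (T * t) by rewrite ltr_pM2l.
  lra.
pose D := [set t | t \in `[0, 1] /\ ~ derivable c t 1].
pose I := [set t | K t /\ exists2 r, 0 < r & forall s, K s -> `|s - t| < r -> s = t].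
(* Isolated record times are removed so that the expansion between record times passes to the
   derivative; time 0 is removed because [phiF] speaks only of positive times. *)
pose S := K `\` (D `|` (I `|` [set 0])).
have nS : ~ mu.-negligible S.
  move=> nS; apply: nK.
  have : mu.-negligible (S `|` (D `|` (I `|` [set 0]))).
    apply: negligibleU => //; apply: negligibleU.
      exact: lipschitz_curve_ae_derivable T0 cL.
    apply: negligibleU; first exact: isolated_negligible.
    by exists [set 0]; split => //; exact: lebesgue_measure_set1.
  apply: negligibleS => t Kt.
  by have [|] := pselect ((D `|` (I `|` [set 0])) t); [right|left].
have dd : 0 < d%:R + 1 :> R by rewrite ltr_wpDl.
have eps0 : 0 < (6 * (d%:R + 1))^-1 :> R by rewrite invr_gt0 mulr_gt0.
have [net [net1 netP]] := @unit_net R d _ eps0.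
have [|e /net1 e1 ne] := @nonnegligible_cone d F c S _ net netP nS.
  move=> t [Kt /not_orP[nD /not_orP[nI n0]]].
  have t01 : t \in `[0, 1] by rewrite in_itv/=; case: Kt.
  have dt : derivable c t 1 by apply: contrapT => nd; apply: nD.
  split => //.
    apply: KF => //; rewrite lt_def; move: t01; rewrite in_itv/= => /andP[-> _].
    by rewrite andbT; apply/eqP.
  apply: (@lt_le_trans _ _ (k * T / 2)); first by rewrite divr_gt0// mulr_gt0.
  apply: derive1_enorm_ge => // r r0; apply: contrapT => h; apply: nI.
  split => //; exists r => // s Ks str; apply/eqP; apply: contrapT => /negP st.
  by apply: h; exists s; split => //; exact: clow.
apply: (@cone_times_not_unrectifiable d F c e e1 _ pu) => nn; apply: ne.
by apply: negligibleS nn; exact: subIsetr.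
Qed.
End curves.

(** * Ultralimits in compact sets *)

Lemma ultralimit_compact (T : topologicalType) (K : set T) (U : set_system nat)
    (x : nat -> T) : UltraFilter U -> compact K -> (forall n, K (x n)) ->
  exists2 l, K l & x @ U --> l.
Proof.
move=> UU cK hx.
have xUK : U (x @^-1` K) by apply: filterS filterT => n _; exact: hx.
have [l [Kl cl]] := cK (x @ U) _ xUK.
exists l => // B Bl.
have [//|nB] := in_ultra_setVsetC (x @^-1` B) UU.
by have [y [nBy By]] := cl (~` B) B nB Bl.
Qed.

Section ultralimits.
Context {R : realType} (U : set_system nat) {UU : UltraFilter U}.

Lemma ucube_compact d : compact (@ucube R d).
Proof.
have := @rV_compact R d (fun=> `[0, 1]%classic) (fun=> @segment_compact R 0 1).
congr compact; apply/seteqP; split => v /= h i; have := h i;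
  by rewrite /= in_itv.
Qed.

Lemma ultralimit_ucube d (x : nat -> 'rV[R]_d) : (forall n, ucube d (x n)) ->
  exists l, ucube d l /\ forall e, 0 < e -> U [set n | enorm (x n - l) < e].
Proof.
move=> hx; have [l cl xl] := ultralimit_compact UU (@ucube_compact d) hx.
exists l; split => // e e0.
have /xl : nbhs l [set y | enorm (y - l) < e] by apply/nbhs_enormP; exists e.
exact.
Qed.

Lemma ultralimit_segment (x : nat -> R) (a b : R) : (forall n, a <= x n <= b) ->
  exists l, a <= l <= b /\ forall e, 0 < e -> U [set n | `|x n - l| < e].
Proof.
move=> hx; have [|l] := ultralimit_compact UU (@segment_compact R a b) (x := x).
  by move=> n; rewrite /= in_itv/=; exact: hx.
rewrite /= in_itv/= => lab xl; exists l; split => // e e0.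
have /xl : nbhs l [set y | `|y - l| < e].
  by apply/nbhs_ballP; exists e => //= y; rewrite /ball/= distrC.
exact.
Qed.
End ultralimits.

(** * Paths with a gain near a purely unrectifiable set *)

Section relaxed_paths.
Context {R : realType} {d : nat}.
Implicit Types (F : set 'rV[R]_d) (e x z : 'rV[R]_d) (w : R -> 'rV[R]_d)
  (j : R -> R) (tau T : R).

(* [j] measures the time spent travelling in direction [-e], at unit speed and
   only within distance [tau] of [F]; the rest of the motion has speed at most
   one. Stating this through increments keeps the notion closed under pointwise
   limits. *)
Definition relaxed_path F e tau w j : Prop :=
  [/\ forall s t, s <= t -> 0 <= j t - j s <= t - s,
      forall s t, s <= t ->
        enorm (w t - w s + (j t - j s) *: e) <= (t - s) - (j t - j s),
      forall s t, s <= t -> j s < j t ->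
        exists u z, [/\ s <= u <= t, F z & enorm (w u - z) <= tau] &
      forall t, ucube d (w t)].

(* Free motion costs [dt] while motion along [-e] near [F] earns [dt / 2]: the gain
   is what [f (w T) - f (w 0)] exceeds the resulting cost by. *)
Definition path_gain (f : 'rV[R]_d -> R) w j T : R :=
  f (w T) - f (w 0) - T + 3 / 2 * (j T - j 0).

(** The displacement of the jumps is undone by free motion, of speed at most one, up to the net
    displacement. *)
Lemma relaxed_path_jump F e tau w j s t : enorm e = 1 ->
  relaxed_path F e tau w j -> s <= t ->
  j t - j s <= (t - s) - (j t - j s) + enorm (w t - w s).
Proof.
move=> e1 [j1 j2 _ _] st; have /andP[j0 _] := j1 _ _ st.
rewrite -lerBlDr; apply: le_trans (j2 _ _ st).
have := lerB_enorm ((j t - j s) *: e) (- (w t - w s)).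
by rewrite enormZ e1 mulr1 ger0_norm// enormN opprK (addrC (_ *: e)).
Qed.

Lemma relaxed_path_lip F e tau w j : enorm e = 1 -> relaxed_path F e tau w j ->
  forall s t, enorm (w s - w t) <= `|s - t|.
Proof.
move=> e1 [j1 j2 _ _] s t; wlog st : s t / s <= t.
  move=> H; have [/H//|/ltW/H] := leP s t.
  by rewrite enormC distrC.
rewrite enormC distrC ger0_norm ?subr_ge0//.
have /andP[j0 _] := j1 _ _ st; have := j2 _ _ st.
have := lerB_enorm (w t - w s) (- ((j t - j s) *: e)).
rewrite enormN opprK enormZ e1 mulr1 ger0_norm//; lra.
Qed.

Lemma ucube_dist x z : ucube d x -> ucube d z -> enorm (x - z) <= d%:R :> R.
Proof.
move=> cx cz; rewrite -[leRHS]mulr1; apply: enorm_le_coord => // i.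
by rewrite !mxE ler_norml; have := cx i; have := cz i; lra.
Qed.

(** With net displacement [D], jumps take time at most [(T + D) / 2], so the gain is at most
    [7 / 4 * D - T / 4], and [D] is at most [d]. *)
Lemma path_gain_bound F e tau w j (f : 'rV[R]_d -> R) T : enorm e = 1 ->
  (forall x y, ucube d x -> ucube d y -> `|f x - f y| <= enorm (x - y)) ->
  relaxed_path F e tau w j -> 0 <= T -> 0 < path_gain f w j T -> T <= 7 * d%:R.
Proof.
move=> e1 fL P T0; rewrite /path_gain => g0.
have := relaxed_path_jump e1 P T0; rewrite subr0 => h.
have [_ _ _ cw] := P.
have [fw _] := ler_dist_split (fL _ _ (cw T) (cw 0)).
have := ucube_dist (cw T) (cw 0) => h2.
have /andP[_] : 0 <= j T - j 0 <= T - 0 by case: P => P1 _ _ _; exact: P1.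
rewrite subr0; lra.
Qed.

(** A limit along an ultrafilter is taken at each time separately, so neither subsequences nor
    equicontinuity are needed; the inequalities on increments pass to it. As the allowed distance to
    [F] tends to 0, jumps of the limit occur on [F] itself. *)
Lemma relaxed_path_ultralimit F e (W : nat -> R -> 'rV[R]_d) (J : nat -> R -> R)
    (U : set_system nat) : UltraFilter U -> \oo `<=` U -> enorm e = 1 ->
  (forall n, relaxed_path F e n.+1%:R^-1 (W n) (J n)) -> (forall n, J n 0 = 0) ->
  closed F ->
  exists w j, [/\ relaxed_path F e 0 w j,
    forall t eps, 0 < eps -> U [set n | enorm (W n t - w t) < eps] &
    forall t eps, 0 < eps -> U [set n | `|J n t - j t| < eps]].
Proof.
move=> UU Uoo e1 WJ J0 cF.
have /choice[w wP] : forall t, exists l, ucube d l /\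
    forall eps, 0 < eps -> U [set n | enorm (W n t - l) < eps].
  by move=> t; apply: ultralimit_ucube => n; case: (WJ n).
have /choice[j jP] : forall t, exists l, - `|t| <= l <= `|t| /\
    forall eps, 0 < eps -> U [set n | `|J n t - l| < eps].
  move=> t; apply: ultralimit_segment => n; case: (WJ n) => j1 _ _ _.
  have [t0|/ltW t0] := leP 0 t.
    by have := j1 _ _ t0; rewrite J0 ger0_norm//; lra.
  by have := j1 _ _ t0; rewrite J0 ler0_norm//; lra.
have wU t : forall eps, 0 < eps -> U [set n | enorm (W n t - w t) < eps].
  exact: (wP t).2.
have jU t : forall eps, 0 < eps -> U [set n | `|J n t - j t| < eps].
  exact: (jP t).2.
exists w, j; split => //; split.
- move=> s t st; apply/andP; split; apply/ler_addgt0Pr => eps eps0.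
    have e2 : 0 < eps / 2 by rewrite divr_gt0.
    have [n [/= h1 h2]] := filter_ex (filterI (jU s _ e2) (jU t _ e2)).
    have [j1 _ _ _] := WJ n; have := j1 _ _ st.
    move: h1 h2; rewrite !ltr_norml; lra.
  have e2 : 0 < eps / 2 by rewrite divr_gt0.
  have [n [/= h1 h2]] := filter_ex (filterI (jU s _ e2) (jU t _ e2)).
  have [j1 _ _ _] := WJ n; have := j1 _ _ st.
  move: h1 h2; rewrite !ltr_norml; lra.
- move=> s t st; apply/ler_addgt0Pr => eps eps0.
  have e8 : 0 < eps / 8 by rewrite divr_gt0.
  have [n [[/= h1 h2] [h3 h4]]] := filter_ex (filterI
    (filterI (jU s _ e8) (jU t _ e8)) (filterI (wU s _ e8) (wU t _ e8))).
  have [_ j2 _ _] := WJ n; have := j2 _ _ st => H.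
  have : enorm (w t - w s + (j t - j s) *: e -
      (W n t - W n s + (J n t - J n s) *: e)) <= eps / 2.
    rewrite [X in enorm X](_ : _ = - (W n t - w t) + ((W n s - w s) +
      ((J n s - j s) - (J n t - j t)) *: e)); last first.
      by apply/rowP => i; rewrite !mxE; ring.
    apply: (le_trans (enormD _ _)); rewrite enormN.
    have := enormD (W n s - w s) ((J n s - j s - (J n t - j t)) *: e).
    rewrite enormZ e1 mulr1.
    have := ler_normB (J n s - j s) (J n t - j t).
    lra.
  have := lerB_enorm (w t - w s + (j t - j s) *: e)
    (W n t - W n s + (J n t - J n s) *: e).
  move: h1 h2; rewrite !ltr_norml; lra.
- move=> s t st jst.
  (* The value [s] is a dummy for those [n] without a jump between [s] and [t]. *)
  have /choice[u uP] : forall n, exists u, s <= u <= t /\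
      (J n s < J n t -> exists2 z, F z & enorm (W n u - z) <= n.+1%:R^-1).
    move=> n; have [jn|jn] := ltP (J n s) (J n t).
      have [_ _ j3 _] := WJ n; have [u [z [sut Fz wz]]] := j3 _ _ st jn.
      by exists u; split => // _; exists z.
    by exists s; rewrite lexx st.
  have [v [vst vU]] := @ultralimit_segment _ U UU u s t (fun n => (uP n).1).
  exists v, (w v); split => //; last by rewrite subrr enorm0.
  apply: closed_enorm => // eps eps0.
  have e4 : 0 < eps / 4 by rewrite divr_gt0.
  (* Errors below half the increment at both ends force [J n] to increase strictly as well. *)
  have jst0 : 0 < (j t - j s) / 2 by rewrite divr_gt0// subr_gt0.
  have Un : U [set n | n.+1%:R^-1 < eps / 4].
    apply: Uoo; have [N Nlt] := ltr_add_invr e4.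
    exists N => // n /= Nn; rewrite add0r in Nlt.
    by apply: le_lt_trans Nlt; rewrite lef_pV2 ?posrE ?ltr0n// ler_nat ltnS.
  have [n [[[/= h1 h2] [h3 h4]] h5]] := filter_ex (filterI (filterI
    (filterI (jU s _ jst0) (jU t _ jst0)) (filterI (wU v _ e4) (vU _ e4))) Un).
  have [|z Fz zW] := (uP n).2.
    by move: h1 h2; rewrite !ltr_norml; lra.
  exists z; split => //.
  have := relaxed_path_lip e1 (WJ n) (u n) v.
  have := enorm_dist z (W n (u n)) (w v).
  have := enorm_dist (W n (u n)) (W n v) (w v).
  have zW' := le_lt_trans zW h5.
  rewrite (enormC z (W n (u n))); rewrite /= in h3 h4; lra.
- by move=> t; exact: (wP t).1.
Qed.

(** Paths of positive gain have bounded duration, so counterexamples at distances [1 / (n + 1)] have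
    an ultralimit, once each [j] is shifted to vanish at 0. For this limit the accumulated gain
    [phi] can rise only through jumps, that is on [F]. *)
Lemma path_gain_small F e (f : 'rV[R]_d -> R) (eps : R) : enorm e = 1 ->
  closed F -> purely_unrectifiable F ->
  (forall x y, ucube d x -> ucube d y -> `|f x - f y| <= enorm (x - y)) ->
  0 < eps -> exists2 tau0, 0 < tau0 & forall w j T,
    relaxed_path F e tau0 w j -> 0 <= T -> path_gain f w j T <= eps.
Proof.
move=> e1 cF pu fL eps0; apply: contrapT => H.
have /choice[X XP] : forall n, exists X : (R -> 'rV[R]_d) * (R -> R) * R,
    [/\ relaxed_path F e n.+1%:R^-1 X.1.1 X.1.2, 0 <= X.2 <= 7 * d%:R,
      X.1.2 0 = 0 & eps < path_gain f X.1.1 X.1.2 X.2].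
  move=> n; apply: contrapT => h; apply: H; exists n.+1%:R^-1.
    by rewrite invr_gt0 ltr0n.
  move=> w j T P T0; rewrite leNgt; apply/negP => g0; apply: h.
  exists (w, (fun t => j t - j 0), T) => /=; split.
  - case: P => j1 j2 j3 j4; split => // s t st.
    + by rewrite opprB addrA subrK; exact: j1.
    + by rewrite opprB addrA subrK; exact: j2.
    + by rewrite ltrD2r; exact: j3.
  - rewrite T0/=; apply: (path_gain_bound e1 fL P T0).
    exact: lt_trans g0.
  - by rewrite subrr.
  - by rewrite /path_gain opprB addrA subrK.
have [U [UU Uoo]] := ultraFilterLemma eventually_filter.
have [||w [j [P wU jU]]] := @relaxed_path_ultralimit F e
  (fun n => (X n).1.1) (fun n => (X n).1.2) U UU Uoo e1 _ _ cF.
- by move=> n; case: (XP n).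
- by move=> n; case: (XP n).
have [T [/andP[T0 _] TU]] := @ultralimit_segment _ U UU (fun n => (X n).2) 0
  (7 * d%:R) (fun n => let: And4 _ h _ _ := XP n in h).
pose phi t := f (w t) - t + 3 / 2 * j t.
have [P1 P2 P3 P4] := P.
have gain : phi 0 + eps / 2 <= phi T.
  have e20 : 0 < eps / 20 by rewrite divr_gt0.
  have [n [[[/= h1 h2] [h3 h4]] h5]] := filter_ex (filterI (filterI
    (filterI (jU 0 _ e20) (jU T _ e20)) (filterI (wU 0 _ e20) (wU T _ e20)))
    (TU _ e20)).
  have [Pn /andP[Tn0 _] j0 gn] := XP n; rewrite /= in h3 h4 h5.
  move: gn; rewrite /path_gain => gn.
  have [_ _ _ cw] := Pn.
  have [a1 _] := ler_dist_split (fL _ _ (cw (X n).2) (cw T)).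
  have [a2 _] := ler_dist_split (fL _ _ (cw T) (P4 T)).
  have [_ a3] := ler_dist_split (fL _ _ (cw 0) (P4 0)).
  have a4 := relaxed_path_lip e1 Pn (X n).2 T.
  have a5 : `|(X n).1.2 (X n).2 - (X n).1.2 T| <= `|(X n).2 - T|.
    have [q1 _ _ _] := Pn.
    have [le|/ltW le] := leP (X n).2 T.
      rewrite [leRHS]distrC [leRHS]ger0_norm ?subr_ge0// ler_norml.
      by have := q1 _ _ le; lra.
    rewrite [leRHS]ger0_norm ?subr_ge0// ler_norml.
    by have := q1 _ _ le; lra.
  move: a5 h1 h2 h5 a4; rewrite ler_norml !ltr_norml /phi => a5 h1 h2 h5 a4.
  have : `|(X n).2 - T| <= eps / 20 by rewrite ler_norml; lra.
  lra.
suff : phi T <= phi 0 by lra.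
have phiL s t : s <= t -> phi t - phi s <= 2 * enorm (w t - w s).
  move=> st; have := relaxed_path_jump e1 P st.
  have [+ _] := ler_dist_split (fL _ _ (P4 t) (P4 s)).
  by have := P1 _ _ st; rewrite /phi; lra.
have {}T0 : 0 < T.
  rewrite lt_def T0 andbT; apply/eqP => TE; move: gain; rewrite TE; lra.
(* The terms of [phi] contribute 1, 1 and 3/2 to its Lipschitz constant, and 4 exceeds their sum. *)
apply: (@unrectifiable_gain _ d F w phi T 4) => //.
- exact: relaxed_path_lip P.
- move=> s t; wlog st : s t / s <= t.
    move=> h; have [/h//|/ltW/h] := leP s t.
    by rewrite distrC (distrC t).
  rewrite distrC (distrC s) (ger0_norm (x := t - s)) ?subr_ge0//.
  have := relaxed_path_lip e1 P t s; rewrite ger0_norm ?subr_ge0// => h.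
  have [h1 h2] := ler_dist_split (fL _ _ (P4 t) (P4 s)).
  by have := P1 _ _ st; rewrite ler_norml /phi; lra.
- move=> t /andP[t0 tT] nF.
  have [r r0 hr] : exists2 r, 0 < r & forall z, F z -> r <= enorm (z - w t).
    apply: contrapT => h; apply: nF; apply: closed_enorm => // r r0.
    apply: contrapT => h2; apply: h; exists r => // z Fz.
    by rewrite leNgt; apply/negP => zr; apply: h2; exists z.
  (* During the last [r / 2] units of time a path of speed at most one stays at distance at least
     [r / 2] from [F], so no jump occurs. *)
  pose s := Num.max 0 (t - r / 2).
  have st : s < t by rewrite gt_max t0 /=; lra.
  exists s; split; first by rewrite le_max lexx st.
  have jE : j t <= j s.
    rewrite leNgt; apply/negP => jst.
    have [u [z [/andP[su ut] Fz]]] := P3 _ _ (ltW st) jst.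
    have := relaxed_path_lip e1 P u t.
    rewrite distrC ger0_norm ?subr_ge0//.
    have := enorm_dist z (w u) (w t); rewrite (enormC z (w u)).
    have := hr _ Fz; have : t - r / 2 <= s by rewrite le_max lexx orbT.
    lra.
  have := relaxed_path_lip e1 P t s; rewrite gtr0_norm ?subr_gt0// => h.
  have [h1 h2] := ler_dist_split (fL _ _ (P4 t) (P4 s)).
  have := P1 _ _ (ltW st); rewrite /phi; lra.
Qed.
End relaxed_paths.

(** * Concatenation of paths and the steep approximation *)

Section path_constructions.
Context {R : realType} {d : nat}.
Implicit Types (F : set 'rV[R]_d) (e x z : 'rV[R]_d) (w : R -> 'rV[R]_d)
  (j : R -> R) (tau T l s t : R).

(** Paths are defined on all of [R]; clamping the parameter lets them rest before time 0 and after
    time [l]. *)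
Definition clamp l t : R := Num.min (Num.max 0 t) l.

Lemma clampP l t : 0 <= l -> 0 <= clamp l t <= l.
Proof.
by move=> l0; rewrite /clamp ge_min lexx orbT le_min l0 le_max lexx.
Qed.

Lemma clamp_lip l s t : 0 <= l -> s <= t -> 0 <= clamp l t - clamp l s <= t - s.
Proof.
move=> l0 st; rewrite /clamp.
have [a1|a1] := leP 0 t; have [a2|a2] := leP 0 s;
  have [b1|b1] := leP _ l; try have [b2|b2] := leP _ l; lra.
Qed.

Lemma clamp0 l : 0 <= l -> clamp l 0 = 0.
Proof. by move=> l0; rewrite /clamp maxxx; apply/min_idPl. Qed.

Lemma clampl l : 0 <= l -> clamp l l = l.
Proof. by move=> l0; rewrite /clamp (max_idPr l0) minxx. Qed.

Lemma clamp_id (l t : R) : 0 <= t <= l -> clamp l t = t.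
Proof. by move=> /andP[t0 tl]; rewrite /clamp (max_idPr t0) (min_idPl tl). Qed.

Lemma relaxed_pathW F e tau tau' w j : tau <= tau' ->
  relaxed_path F e tau w j -> relaxed_path F e tau' w j.
Proof.
move=> tt [j1 j2 j3 j4]; split => // s t st jst.
have [u [z [sut Fz wz]]] := j3 _ _ st jst.
by exists u, z; split => //; exact: le_trans tt.
Qed.

Lemma relaxed_path_cat F e tau w1 j1 w2 j2 T :
  relaxed_path F e tau w1 j1 -> relaxed_path F e tau w2 j2 -> w1 T = w2 0 ->
  relaxed_path F e tau (fun t => if t <= T then w1 t else w2 (t - T))
    (fun t => if t <= T then j1 t else j1 T + (j2 (t - T) - j2 0)).
Proof.
move=> [p1 p2 p3 p4] [q1 q2 q3 q4] wT; split.
- move=> s t st; have [tT|Tt] := leP t T.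
    by rewrite (le_trans st tT); exact: p1.
  have t0 : 0 <= t - T by rewrite subr_ge0 ltW.
  have [sT|Ts] := leP s T.
    by have := p1 _ _ sT; have := q1 _ _ t0; lra.
  have sTt : s - T <= t - T by rewrite lerD2r.
  by have := q1 _ _ sTt; lra.
- move=> s t st; have [tT|Tt] := leP t T.
    by rewrite (le_trans st tT); exact: p2.
  have t0 : 0 <= t - T by rewrite subr_ge0 ltW.
  have [sT|Ts] := leP s T.
    rewrite [X in enorm X](_ : _ = (w1 T - w1 s + (j1 T - j1 s) *: e) +
      (w2 (t - T) - w2 0 + (j2 (t - T) - j2 0) *: e)); last first.
      by rewrite wT; apply/rowP => i; rewrite !mxE; ring.
    by have := p2 _ _ sT; have := q2 _ _ t0; have := enormD
      (w1 T - w1 s + (j1 T - j1 s) *: e)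
      (w2 (t - T) - w2 0 + (j2 (t - T) - j2 0) *: e); lra.
  have sTt : s - T <= t - T by rewrite lerD2r.
  have -> : j1 T + (j2 (t - T) - j2 0) - (j1 T + (j2 (s - T) - j2 0)) =
    j2 (t - T) - j2 (s - T) by ring.
  by have := q2 _ _ sTt; have -> : t - T - (s - T) = t - s by ring.
- move=> s t st; have [tT|Tt] := leP t T.
    rewrite (le_trans st tT) => jst.
    have [u [z [/andP[su ut] Fz wz]]] := p3 _ _ st jst.
    by exists u, z; split; rewrite ?su ?ut ?(le_trans ut tT).
  have t0 : 0 <= t - T by rewrite subr_ge0 ltW.
  have [sT|Ts] := leP s T => jst.
    have [jsT|jTs] := ltP (j1 s) (j1 T).
      have [u [z [/andP[su uT] Fz wz]]] := p3 _ _ sT jsT.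
      by exists u, z; split; rewrite ?uT// su (le_trans uT)// ltW.
    have j0t : j2 0 < j2 (t - T) by lra.
    have [u [z [/andP[u0 uT] Fz wz]]] := q3 _ _ t0 j0t.
    exists (u + T), z; split => //.
      by apply/andP; split; lra.
    (* At the junction the concatenation follows the first path, so a witness at the initial time of
       the second one needs the matching condition. *)
    have [uT0|_] := leP (u + T) T; last by rewrite addrK.
    have uE : u = 0 by lra.
    by move: wz; rewrite uE add0r wT.
  have sTt : s - T <= t - T by rewrite lerD2r.
  have j0t : j2 (s - T) < j2 (t - T) by lra.
  have [u [z [/andP[su ut] Fz wz]]] := q3 _ _ sTt j0t.
  exists (u + T), z; split => //.
    by apply/andP; split; lra.
  have [uT0|_] := leP (u + T) T; last by rewrite addrK.
  lra.
- by move=> t; case: ifP => _; [exact: p4|exact: q4].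
Qed.

Lemma ucube_convex x z (a : R) : ucube d x -> ucube d z -> 0 <= a <= 1 ->
  ucube d (x + a *: (z - x)).
Proof.
move=> cx cz a01 i; rewrite !mxE.
have /andP[x0 x1] := cx i; have /andP[z0 z1] := cz i; nra.
Qed.

Lemma relaxed_path_free F e tau x z : ucube d x -> ucube d z ->
  relaxed_path F e tau
    (fun t => x + (clamp (enorm (z - x)) t / enorm (z - x)) *: (z - x)) (fun=> 0).
Proof.
move=> cx cz; set l := enorm (z - x); have l0 : 0 <= l by exact: enorm_ge0.
split.
- by move=> s t st; rewrite subrr lexx subr_ge0.
- move=> s t st; rewrite subrr scale0r addr0 subr0.
  rewrite [X in enorm X](_ : _ = ((clamp l t - clamp l s) / l) *: (z - x)).
    rewrite enormZ -/l; have /andP[h1 h2] := clamp_lip l0 st.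
    rewrite ger0_norm ?divr_ge0//; apply: le_trans h2.
    have [l00|ln] := eqVneq l 0; first by rewrite [X in _ * X]l00 mulr0.
    by rewrite divfK.
  by apply/rowP => i; rewrite !mxE; ring.
- by move=> s t _; rewrite ltxx.
- move=> t; apply: ucube_convex => //.
  have /andP[h1 h2] := clampP t l0; rewrite divr_ge0//=.
  have [->|ln] := eqVneq l 0; first by rewrite invr0 mulr0.
  by rewrite ler_pdivrMr ?mul1r// lt_def ln.
Qed.

(** The segment is run from [z + tau *: e] to [z] and lies within [tau] of [z], so all of it may
    count as a jump. *)
Lemma relaxed_path_jump_segment F e tau z : enorm e = 1 -> 0 < tau -> F z ->
  ucube d z -> ucube d (z + tau *: e) ->
  relaxed_path F e tau (fun t => z + (tau - clamp tau t) *: e) (clamp tau).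
Proof.
move=> e1 t0 Fz cz cze; have tau0 := ltW t0; split.
- by move=> s t; exact: clamp_lip.
- move=> s t st; rewrite [X in enorm X](_ : _ = 0).
    by rewrite enorm0; have := clamp_lip tau0 st; lra.
  by apply/rowP => i; rewrite !mxE; ring.
- move=> s t st _; exists s, z; split; rewrite ?lexx ?st//.
  rewrite addrAC subrr add0r enormZ e1 mulr1; have := clampP s tau0.
  by rewrite ler_norml; lra.
- move=> t; have := @ucube_convex z (z + tau *: e) ((tau - clamp tau t) / tau) cz cze.
  rewrite addrAC subrr add0r scalerA divfK ?gt_eqF//; apply.
  have /andP[h1 h2] := clampP t tau0; rewrite divr_ge0 ?subr_ge0//=.
  by rewrite ler_pdivrMr// mul1r; lra.
Qed.

(* The infimum of these costs is the steep approximation of [f]: jumps along [e] at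
   points of [F] force it to increase by [tau / 2] there. *)
Definition path_costs F e tau (f : 'rV[R]_d -> R) x : set R :=
  [set c | exists w j T, [/\ relaxed_path F e tau w j, 0 <= T, w T = x &
     c = f (w 0) + T - 3 / 2 * (j T - j 0)]].

Lemma path_costs_free F e tau f x z c : ucube d x -> ucube d z ->
  path_costs F e tau f x c -> path_costs F e tau f z (c + enorm (z - x)).
Proof.
move=> cx cz [w [j [T [P T0 wT ->]]]].
have l0 := enorm_ge0 (z - x).
have Q := relaxed_path_free F e tau cx cz.
have wQ : w T = x + (clamp (enorm (z - x)) 0 / enorm (z - x)) *: (z - x).
  by rewrite clamp0// mul0r scale0r addr0.
have PQ := relaxed_path_cat P Q wQ.
eexists; eexists; exists (T + enorm (z - x)); split; first exact: PQ.
- by rewrite addr_ge0.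
- have [h|h] := leP (T + enorm (z - x)) T.
    have zx : enorm (z - x) = 0 by lra.
    rewrite zx addr0 wT; apply/eqP; rewrite eq_sym -subr_eq0 -enorm_eq0.
    by rewrite zx.
  rewrite addrAC subrr add0r clampl// divff ?scale1r ?subrKC//.
  by apply/eqP => zx; move: h; rewrite zx addr0 ltxx.
- rewrite /= T0; have [h|h] := leP (T + enorm (z - x)) T; last by lra.
  have zx : enorm (z - x) = 0 by lra.
  by rewrite zx !addr0.
Qed.

Lemma path_costs_jump F e tau f z c : enorm e = 1 -> 0 < tau -> F z ->
  ucube d z -> ucube d (z + tau *: e) ->
  path_costs F e tau f (z + tau *: e) c -> path_costs F e tau f z (c - tau / 2).
Proof.
move=> e1 t0 Fz cz cze [w [j [T [P T0 wT ->]]]].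
have tau0 := ltW t0.
have Q := relaxed_path_jump_segment e1 t0 Fz cz cze.
have wQ : w T = z + (tau - clamp tau 0) *: e by rewrite clamp0// subr0.
have PQ := relaxed_path_cat P Q wQ.
have hT : (T + tau <= T) = false by apply/negbTE; rewrite -ltNge; lra.
eexists; eexists; exists (T + tau); split; first exact: PQ.
- by rewrite addr_ge0.
- by rewrite /= hT addrAC subrr add0r clampl// subrr scale0r addr0.
- have TT : T + tau - T = tau by ring.
  by rewrite /= hT T0 TT clampl// clamp0//; lra.
Qed.

(** Appending a free segment to a path gives the Lipschitz bound, appending a jump of duration
    [tau], of cost [tau - 3 / 2 * tau], gives the steepness, and the bound on gains is exactly the
    lower bound [f - eps]. *)
Lemma steep_approximation F e tau (f : 'rV[R]_d -> R) (eps : R) :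
  enorm e = 1 -> 0 < tau ->
  (forall x y, ucube d x -> ucube d y -> `|f x - f y| <= enorm (x - y)) ->
  (forall w j T, relaxed_path F e tau w j -> 0 <= T -> path_gain f w j T <= eps) ->
  exists g, [/\ Lip1 d g,
    forall x, ucube d x -> f x - eps <= g x <= f x &
    forall z, F z -> ucube d z -> ucube d (z + tau *: e) ->
      g z <= g (z + tau *: e) - tau / 2].
Proof.
move=> e1 tau0 fL gain.
pose C := path_costs F e tau f.
have C0 x : ucube d x -> C x (f x).
  move=> cx; exists (fun=> x), (fun=> 0), 0; split => //; last by lra.
  split => // s t st.
  - by rewrite subrr lexx subr_ge0.
  - by rewrite !subrr scale0r addr0 enorm0 !subr0 subr_ge0.
  - by rewrite ltxx.
have Clb x c : C x c -> f x - eps <= c.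
  move=> [w [j [T [P T0 <- ->]]]]; have := gain _ _ _ P T0.
  by rewrite /path_gain; lra.
have hC x : ucube d x -> has_inf (C x).
  move=> cx; split; first by exists (f x); exact: C0.
  by exists (f x - eps) => c; exact: Clb.
pose g x := if `[< ucube d x >] then inf (C x) else 0.
have gE x : ucube d x -> g x = inf (C x) by move=> cx; rewrite /g asboolT.
have half x z : ucube d x -> ucube d z -> g z <= g x + enorm (z - x).
  move=> cx cz; rewrite !gE// -lerBlDr; apply: lb_le_inf; first exact: (hC _ cx).1.
  move=> c Cc; rewrite lerBlDr; apply: (ge_inf (hC _ cz).2).
  exact: path_costs_free.
exists g; split.
- split; last by move=> x cx; rewrite /g asboolF.
  move=> x y cx cy; rewrite ler_norml; have := half _ _ cx cy.
  by have := half _ _ cy cx; rewrite (enormC y); lra.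
- move=> x cx; rewrite gE//; apply/andP; split.
    by apply: lb_le_inf; [exact: (hC _ cx).1|move=> c; exact: Clb].
  by apply: (ge_inf (hC _ cx).2); exact: C0.
- move=> z Fz cz cze; rewrite !gE// -lerBlDr opprK.
  apply: lb_le_inf; first exact: (hC _ cze).1.
  move=> c Cc; rewrite -lerBrDr; apply: (ge_inf (hC _ cz).2).
  exact: path_costs_jump.
Qed.
End path_constructions.

(** * Differentiability on a coverable set is meagre *)

Section meagre.
Context {R : realType} {d : nat}.
Implicit Types (F : set 'rV[R]_d) (e : 'rV[R]_d) (f g : 'rV[R]_d -> R).

Definition flat_somewhere F e (delta : R) : set ('rV[R]_d -> R) :=
  [set f | exists2 x, F x & forall t, 0 < t < delta ->
     f (x + t *: e) - f x <= t / 4].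

Lemma flat_somewhere_nowhere_dense F e (delta r0 : R) : enorm e = 1 ->
  closed F -> purely_unrectifiable F -> 0 < delta -> 0 < r0 ->
  (forall z t, F z -> 0 <= t <= r0 -> ucube d (z + t *: e)) ->
  nowhere_dense_Lip1 (flat_somewhere F e delta).
Proof.
move=> e1 cF pu delta0 r00 Fcube f r [fL _] rp.
have r2 : 0 < r / 2 by rewrite divr_gt0.
have [tau0 t00 gain0] := path_gain_small e1 cF pu fL r2.
pose tau := Num.min tau0 (Num.min r0 (delta / 2)).
have tauP : 0 < tau by rewrite !lt_min t00 r00 divr_gt0.
have taur0 : tau <= r0 by rewrite !ge_min lexx !orbT.
have taud : tau <= delta / 2 by rewrite !ge_min lexx !orbT.
have gain w j T : relaxed_path F e tau w j -> 0 <= T -> path_gain f w j T <= r / 2.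
  move=> P; apply: gain0; apply: relaxed_pathW P.
  by rewrite ge_min lexx.
have [g [gL gf gF]] := steep_approximation e1 tauP fL gain.
(* [r / 4] fits beside the error [r / 2] of [g]. An error [tau / 16] at both ends lowers the
   increment [tau / 2] by at most [tau / 8], which leaves more than [tau / 4]. *)
exists g, (Num.min (r / 4) (tau / 16)); split => //; split.
  by rewrite lt_min !divr_gt0.
split.
  move=> h [hL [r' [+ hr']]]; rewrite lt_min => /andP[rr _].
  split => //; exists (r / 2 + r / 4); split; first by lra.
  move=> x cx; have := hr' _ cx; have := gf _ cx; rewrite !ler_norml; lra.
rewrite -subset0 => h [[hL [r' [+ hr']]] [x Fx hx]].
rewrite lt_min => /andP[_ rt].
have cx : ucube d x by have := Fcube x 0 Fx; rewrite scale0r addr0 lexx (ltW r00); apply.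
have cxe : ucube d (x + tau *: e) by apply: Fcube; rewrite // taur0 ltW.
have := hx tau; rewrite tauP/= => /(_ _); have : tau < delta by lra.
move=> -> /(_ isT).
have := gF _ Fx cx cxe; have := hr' _ cx; have := hr' _ cxe.
rewrite !ler_norml; lra.
Qed.

Lemma Lip1_opp f : Lip1 d f -> Lip1 d (fun x => - f x).
Proof.
move=> [fL f0]; split; last by move=> x /f0 ->; rewrite oppr0.
by move=> x y cx cy; rewrite opprK addrC distrC; exact: fL.
Qed.

Lemma sup_ball_opp f g (r : R) : sup_ball f r (fun x => - g x) ->
  sup_ball (fun x => - f x) r g.
Proof.
move=> [gL [r' [rr' h]]]; split.
  have := Lip1_opp gL.
  by rewrite (_ : (fun x => - - g x) = g)//; apply/funext => x; rewrite opprK.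
by exists r'; split => // x cx; have := h _ cx; rewrite opprK -opprD normrN.
Qed.

Lemma nowhere_dense_opp (N : set ('rV[R]_d -> R)) : nowhere_dense_Lip1 N ->
  nowhere_dense_Lip1 [set f | N (fun x => - f x)].
Proof.
move=> hN f r fL r0.
have oppK h : (fun x => - - h x) = h :> ('rV[R]_d -> R).
  by apply/funext => x; rewrite opprK.
have [g [s [gL [s0 [gs gN]]]]] := hN _ r (Lip1_opp fL) r0.
exists (fun x => - g x), s; split; first exact: Lip1_opp.
split => //; split.
  move=> h hs; have : sup_ball g s (fun x => - h x).
    by rewrite -[g]oppK; apply: sup_ball_opp; rewrite oppK.
  by move=> /gs /sup_ball_opp; rewrite oppK.
rewrite -subset0 => h [hs Nh].
have : (sup_ball g s `&` N) (fun x => - h x).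
  by split => //; rewrite -[g]oppK; apply: sup_ball_opp; rewrite oppK.
by rewrite gN.
Qed.

Lemma nowhere_dense_set0 : nowhere_dense_Lip1 (set0 : set ('rV[R]_d -> R)).
Proof. by move=> f r fL r0; exists f, r; do !split => //; rewrite setI0. Qed.

Lemma meagre_countable (J : countType) (N : J -> set ('rV[R]_d -> R)) M :
  (forall i, nowhere_dense_Lip1 (N i)) -> M `<=` \bigcup_i N i ->
  meagre_Lip1 M.
Proof.
move=> hN MN; exists (fun n => if unpickle n is Some i then N i else set0); split.
  by move=> n; case: unpickle => [i|]; [exact: hN|exact: nowhere_dense_set0].
move=> f /MN[i _ Nif]; exists (pickle i); [exact: I|by rewrite pickleK].
Qed.

Lemma meagreU (M M' : set ('rV[R]_d -> R)) : meagre_Lip1 M -> meagre_Lip1 M' ->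
  meagre_Lip1 (M `|` M').
Proof.
move=> [N [hN MN]] [N' [hN' MN']].
apply: (@meagre_countable (nat * bool)%type
  (fun i => if i.2 then N i.1 else N' i.1)) => [|f].
  by move=> [n []]; [exact: hN|exact: hN'].
by move=> [/MN[n _ Nn]|/MN'[n _ Nn]]; [exists (n, true)|exists (n, false)].
Qed.

(** Baire's theorem by nested balls. The limit is at distance at most, not less than, the radius of
    each ball; doubling the radii in the step puts it strictly inside. *)
Lemma Lip1_not_meagre : ~ meagre_Lip1 (@Lip1 R d).
Proof.
move=> [N [hN subN]].
pose good (p : ('rV[R]_d -> R) * R) := Lip1 d p.1 /\ 0 < p.2.
have /choice[step stepP] : forall np : nat * (('rV[R]_d -> R) * R),
    exists p', good np.2 -> [/\ good p', p'.2 <= np.1.+1%:R^-1,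
      sup_ball p'.1 (2 * p'.2) `<=` sup_ball np.2.1 np.2.2 &
      sup_ball p'.1 (2 * p'.2) `&` N np.1 = set0].
  move=> [n [f r]]; have [[fL r0]|ng] := pselect (good (f, r)); last by exists (f, r).
  have [g [s [gL [s0 [gs gN]]]]] := hN n f r fL r0.
  exists (g, Num.min (s / 2) n.+1%:R^-1) => _.
  have sub : sup_ball g (2 * Num.min (s / 2) n.+1%:R^-1) `<=` sup_ball g s.
    move=> h [hL [r' [rr' hr]]]; split => //; exists r'; split => //.
    apply: lt_le_trans rr' _; rewrite -ler_pdivlMl// mulrC.
    by rewrite ge_min lexx.
  split => /=.
  - by split => //=; rewrite lt_min divr_gt0// invr_gt0 ltr0n.
  - by rewrite ge_min lexx orbT.
  - exact: subset_trans gs.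
  - by rewrite -subset0 -gN; apply: setSI.
pose fix S n : ('rV[R]_d -> R) * R :=
  if n is m.+1 then step (m, S m) else ((fun=> 0), 1).
have goodS n : good (S n).
  elim: n => [|n ih] /=; last by case: (stepP (n, S n) ih).
  split => //=; split => // x y _ _; rewrite subrr normr0; exact: enorm_ge0.
have SP n : [/\ (S n.+1).2 <= n.+1%:R^-1,
    sup_ball (S n.+1).1 (2 * (S n.+1).2) `<=` sup_ball (S n).1 (S n).2 &
    sup_ball (S n.+1).1 (2 * (S n.+1).2) `&` N n = set0].
  by have [_ h1 h2 h3] := stepP (n, S n) (goodS n).
have ball_in n : sup_ball (S n).1 (S n).2 (S n).1.
  split; first exact: (goodS n).1.
  exists 0; split; first exact: (goodS n).2.
  by move=> x _; rewrite subrr normr0.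
have nest n m : sup_ball (S (m + n)%N).1 (S (m + n)%N).2 `<=` sup_ball (S n).1 (S n).2.
  elim: m => [|m ih]//; apply: subset_trans ih => h hh.
  have [_ h2 _] := SP (m + n)%N; apply: h2.
  case: hh => hL [r' [rr' hr]]; split => //; exists r'; split => //.
  have := (goodS (m + n).+1%N).2; rewrite addSn in rr'; lra.
have close n m x : ucube d x -> `|(S n).1 x - (S (m + n)%N).1 x| <= (S n).2.
  move=> cx; have [_ [r' [rr' hr]]] := nest n m _ (ball_in (m + n)%N).
  by apply: (le_trans (hr _ cx)); exact: ltW.
have cross n m x : ucube d x -> (S n).1 x - (S n).2 <= (S m).1 x + (S m).2.
  move=> cx; have := (goodS n).2; have := (goodS m).2.
  have [nm|/ltnW mn] := leqP n m.
    by have := close n (m - n)%N x cx; rewrite subnK// ler_norml; lra.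
  by have := close m (n - m)%N x cx; rewrite subnK// ler_norml; lra.
have /choice[l lP] : forall x, exists l : R, ucube d x ->
    forall n, `|(S n).1 x - l| <= (S n).2.
  move=> x; have [cx|ncx] := pselect (ucube d x); last by exists 0.
  have [l lP] := @nested_limit R (fun n => (S n).1 x) (fun n => (S n).2)
    (fun n m => cross n m x cx).
  by exists l.
pose h x := if `[< ucube d x >] then l x else 0.
have hE n x : ucube d x -> `|(S n).1 x - h x| <= (S n).2.
  by move=> cx; rewrite /h asboolT//; exact: lP.
have hL : Lip1 d h.
  split; last by move=> x cx; rewrite /h asboolF.
  move=> x y cx cy; apply/ler_addgt0Pr => eps eps0.
  have e2 : 0 < eps / 2 by rewrite divr_gt0.
  have [n nlt] := ltr_add_invr e2; rewrite add0r in nlt.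
  have [s1 _ _] := SP n; have sn := le_lt_trans s1 nlt.
  have := hE n.+1 x cx; have := hE n.+1 y cy.
  have [[gl _] _] := goodS n.+1; have := gl _ _ cx cy.
  by rewrite !ler_norml; lra.
have [n _ Nh] := subN _ hL.
have [_ _ h3] := SP n.
have : (sup_ball (S n.+1).1 (2 * (S n.+1).2) `&` N n) h.
  split => //; split => //; exists (S n.+1).2; split.
    by have := (goodS n.+1).2; lra.
  by move=> x cx; exact: hE.
by rewrite h3.
Qed.

(** These closed sets exhaust the open cube, and their points can move by [r] without leaving the
    cube. *)
Definition subcube (r : R) : set 'rV[R]_d := [set x | forall i, r <= x ord0 i <= 1 - r].

Lemma subcube_closed (r : R) : closed (subcube r).
Proof.
move=> x clx i; have near_pt := closure_enorm clx.
have dist eps : 0 < eps -> r - eps <= x ord0 i <= 1 - r + eps.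
  move=> eps0; have [y [cy yx]] := near_pt _ eps0.
  have := le_lt_trans (normr_coord_le_enorm (y - x) i) yx.
  by rewrite !mxE ltr_norml; have := cy i; lra.
apply/andP; split; apply/ler_addgt0Pr => eps eps0; have := dist _ eps0; lra.
Qed.

(** At a point of differentiability the derivative along [e] is either nonpositive or nonnegative,
    so [f] or [- f] has difference quotients at most 1/4 at all small scales. *)
Lemma unrectifiable_differentiable_meagre (P A : set 'rV[R]_d) : (1 <= d)%N ->
  A `<=` open_cube d -> Fsigma P -> purely_unrectifiable P -> A `<=` P ->
  meagre_Lip1 [set f | Lip1 d f /\ exists x, A x /\ differentiable f x].
Proof.
move=> d1 Acube [F [cF PE]] pu AP.
pose e : 'rV[R]_d := \row_i (i == Ordinal d1)%:R.
have e1 : enorm e = 1 by exact: enorm_basis.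
have Ninv n : 0 < n.+1%:R^-1 :> R by rewrite invr_gt0 ltr0n.
pose G (i : nat * nat) := F i.1 `&` subcube i.2.+1%:R^-1.
have cG i : closed (G i) by apply: closedI; [exact: cF|exact: subcube_closed].
have puG i : purely_unrectifiable (G i).
  move=> gam lgam; apply: negligibleS (pu _ lgam) => t [t01 [Ft _]].
  by split => //; rewrite PE; exists i.1.
have nd i k : nowhere_dense_Lip1 (flat_somewhere (G i) e k.+1%:R^-1).
  apply: (flat_somewhere_nowhere_dense (r0 := i.2.+1%:R^-1)) => //.
  move=> z t [_ sz] /andP[t0 tr] l; rewrite !mxE.
  move: (sz l) (Ninv i.2) tr; set q := _^-1.
  by case: (l == _); rewrite ?mulr1 ?mulr0; lra.
apply: (@meagre_countable ((nat * nat) * nat * bool)%type (fun i =>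
  if i.2 then flat_somewhere (G i.1.1) e i.1.2.+1%:R^-1
  else [set f | flat_somewhere (G i.1.1) e i.1.2.+1%:R^-1 (fun x => - f x)])).
  by move=> [[i k] []] /=; [exact: nd|apply: nowhere_dense_opp; exact: nd].
move=> f [fL [x [Ax dfx]]].
have [n _ Fx] : (\bigcup_n F n) x by rewrite -PE; exact: AP.
have [m sm] : exists m, subcube m.+1%:R^-1 x.
  have /choice[M MP] : forall i, exists m, m.+1%:R^-1 <= x ord0 i <= 1 - m.+1%:R^-1.
    move=> i; have /andP[x0 x1] := Acube _ Ax i.
    have x10 : 0 < 1 - x ord0 i by lra.
    have [m1 h1] := ltr_add_invr x0; have [m2 h2] := ltr_add_invr x10.
    rewrite add0r in h1 h2; exists (maxn m1 m2).
    have i1 : (maxn m1 m2).+1%:R^-1 <= m1.+1%:R^-1 :> R.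
      by rewrite lef_pV2 ?posrE ?ltr0n// ler_nat ltnS leq_maxl.
    have i2 : (maxn m1 m2).+1%:R^-1 <= m2.+1%:R^-1 :> R.
      by rewrite lef_pV2 ?posrE ?ltr0n// ler_nat ltnS leq_maxr.
    move: i1 i2 h1 h2; set q := _^-1; set q1 := m1.+1%:R^-1.
    by set q2 := m2.+1%:R^-1; lra.
  exists (\max_i M i) => i; have := MP i.
  have : (\max_i M i).+1%:R^-1 <= (M i).+1%:R^-1 :> R.
    by rewrite lef_pV2 ?posrE ?ltr0n// ler_nat ltnS leq_bigmax.
  by set q := _^-1; set q1 := (M i).+1%:R^-1; lra.
have Gx : G (n, m) x by split.
have q4 : 0 < 4^-1 :> R by rewrite invr_gt0.
have [rho rho0 hrho] := derivable_eps (diff_derivable (v := e) dfx) q4.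
have [k klt] := ltr_add_invr rho0; rewrite add0r in klt.
have small t : 0 < t < k.+1%:R^-1 ->
    `|f (x + t *: e) - f x - t * 'D_e f x| <= t / 4.
  move=> /andP[t0 tk]; have := hrho t; rewrite gtr0_norm// (lt_trans tk klt).
  by rewrite [_^-1 * t]mulrC; exact.
have [D0|D0] := leP ('D_e f x) 0.
  exists ((n, m), k, true) => //=; exists x => // t tk.
  have := small _ tk; have /andP[t0 _] := tk.
  have : t * 'D_e f x <= 0 by rewrite mulr_ge0_le0// ltW.
  by rewrite ler_norml; lra.
exists ((n, m), k, false) => //=; exists x => // t tk.
have := small _ tk; have /andP[t0 _] := tk.
have : 0 <= t * 'D_e f x by rewrite mulr_ge0// ltW.
by rewrite ler_norml; lra.
Qed.

(** Otherwise [Lip1] would be the union of two meagre sets. *)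
Lemma residual_not_coverable (A : set 'rV[R]_d) : (1 <= d)%N ->
  A `<=` open_cube d ->
  residual_Lip1 [set f | Lip1 d f /\ exists x, A x /\ differentiable f x] ->
  ~ exists P : set 'rV[R]_d, Fsigma P /\ purely_unrectifiable P /\ A `<=` P.
Proof.
move=> d1 Acube res [P [FP [pu AP]]].
apply: Lip1_not_meagre.
have := meagreU (unrectifiable_differentiable_meagre d1 Acube FP pu AP) res.
move=> [N [hN sub]]; exists N; split => // f fL; apply: sub.
have [h|h] := pselect (exists x, A x /\ differentiable f x); first by left.
by right; split => // -[].
Qed.
End meagre.

(** * The Banach-Mazur game in Lip1 *)

Section banach_mazur.
Context {R : realType} {d : nat}.
Local Notation fn := ('rV[R]_d -> R).

Lemma sup_ball_open (f h : fn) (r : R) : sup_ball f r h ->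
  exists2 r', 0 < r' & sup_ball h r' `<=` sup_ball f r.
Proof.
move=> [hL [s [sr hs]]]; exists ((r - s) / 2); first by rewrite divr_gt0// subr_gt0.
move=> g [gL [r' [rr' gr']]]; split => //; exists (s + r'); split; first by lra.
move=> x cx; have := hs _ cx; have := gr' _ cx; rewrite !ler_norml; lra.
Qed.

(* The levels are maximal disjoint families of positions reachable under the
   strategy: disjointness makes the positions containing a given function
   automatically a run of the game, and maximality makes each level dense. *)
Lemma banach_mazur (C : Type) (B : C -> set fn) (V : nat -> set C)
    (S : nat -> C -> C -> Prop) (M : set fn) :
  (forall k c, V k c -> exists g r, [/\ Lip1 d g, 0 < r & B c = sup_ball g r]) ->
  (forall f r, Lip1 d f -> 0 < r -> exists2 c, V 0%N c & B c `<=` sup_ball f r) ->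
  (forall k c f r, V k c -> Lip1 d f -> 0 < r -> sup_ball f r `<=` B c ->
     exists c', [/\ V k.+1 c', S k c c' & B c' `<=` sup_ball f r]) ->
  (forall f cs, Lip1 d f -> (forall k, V k (cs k)) ->
     (forall k, S k (cs k) (cs k.+1)) -> (forall k, B (cs k) f) -> M f) ->
  residual_Lip1 M.
Proof.
move=> balls root step win.
pose level (D : set C) : set C := sval (ex_maximal_disjoint_subcollection B D).
have levelP D : maximal_disjoint_subcollection B (level D) D.
  by rewrite /level; case: ex_maximal_disjoint_subcollection.
pose fix F k : set C := if k is j.+1
  then level [set c' | V j.+1 c' /\ exists c, [/\ F j c, S j c c' & B c' `<=` B c]]
  else level (V 0%N).
have FV k : F k `<=` V k.
  by case: k => [|k] c; [have [sub _ _] := levelP (V 0%N); exact: sub|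
    move=> Fc; have [sub _ _] := levelP [set c' | V k.+1 c' /\
      exists c, [/\ F k c, S k c c' & B c' `<=` B c]]; case: (sub _ Fc)].
(* If [c] was not selected, maximality yields a selected position whose ball meets that of [c], and
   a small ball around a common function serves. *)
have inter D c (f : fn) r : D `<=` \bigcup_k V k -> D c -> B c `<=` sup_ball f r ->
    exists c' f' r', [/\ level D c', Lip1 d f', 0 < r', sup_ball f' r' `<=` B c' &
      sup_ball f' r' `<=` sup_ball f r].
  move=> DV Dc Bcf; have [sub triv maxi] := levelP D.
  have [k _ Vc] := DV _ Dc; have [g [s [gL s0 BcE]]] := balls _ _ Vc.
  have [lc|nlc] := pselect (level D c).
    by exists c, g, s; split => //; rewrite -?BcE.
  have [c' [lc' [h [h1 h2]]]] : exists c', level D c' /\ B c' `&` B c !=set0.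
    apply: contrapT => nex; apply: (maxi (level D `|` [set c])).
    - split; first by move=> x lx; left.
      by move=> sub2; apply: nlc; apply: sub2; right.
    - by move=> x [/sub//|->].
    - move=> x y [lx|->] [ly|->] xy.
      + exact: triv.
      + by exfalso; apply: nex; exists x.
      + by exfalso; apply: nex; exists y; split => //; rewrite setIC.
      + by [].
  have [k' _ Vc'] := DV _ (sub _ lc').
  have [g' [s' [g'L s'0 Bc'E]]] := balls _ _ Vc'.
  rewrite BcE in h2; rewrite Bc'E in h1.
  have [r1 r10 sub1] := sup_ball_open h1; have [r2 r20 sub2] := sup_ball_open h2.
  exists c', h, (Num.min r1 r2).
  have shrink r3 : Num.min r1 r2 <= r3 -> sup_ball h (Num.min r1 r2) `<=` sup_ball h r3.
    move=> le3 u [uL [q [qlt uq]]]; split => //; exists q; split => //.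
    exact: lt_le_trans le3.
  split => //; first by case: h1.
  - by rewrite lt_min r10.
  - rewrite Bc'E; apply: subset_trans sub1; apply: shrink.
    by rewrite ge_min lexx.
  - apply: subset_trans Bcf; rewrite BcE; apply: subset_trans sub2; apply: shrink.
    by rewrite ge_min lexx orbT.
have dense k : forall f r, Lip1 d f -> 0 < r -> exists c f' r',
    [/\ F k c, Lip1 d f', 0 < r', sup_ball f' r' `<=` B c &
      sup_ball f' r' `<=` sup_ball f r].
  elim: k => [|k ih] f r fL r0.
    have [c Vc Bc] := root _ _ fL r0.
    by apply: inter Vc Bc => x Vx; exists 0%N.
  have [c [f1 [r1 [Fc f1L r10 sub1 sub2]]]] := ih _ _ fL r0.
  have [c' [Vc' Sc' Bc']] := step _ _ _ _ (FV _ _ Fc) f1L r10 sub1.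
  apply: (inter _ c') => /=.
  - by move=> x [Vx _]; exists k.+1.
  - split => //; exists c; split => //; exact: subset_trans sub1.
  - exact: subset_trans sub2.
exists (fun k => Lip1 d `\` \bigcup_(c in F k) B c); split.
  move=> k f r fL r0.
  have [c [f' [r' [Fc f'L r'0 sub1 sub2]]]] := dense k _ _ fL r0.
  exists f', r'; do 3!split => //.
  rewrite -subset0 => h [hb [_ nh]]; apply: nh; exists c => //; exact: sub1.
move=> f [fL nM]; apply: contrapT => nN; apply: nM.
have /choice[cs csP] : forall k, exists c, F k c /\ B c f.
  move=> k; apply: contrapT => h; apply: nN; exists k => //; split => //.
  by move=> [c Fc Bcf]; apply: h; exists c.
apply: (win f cs) => // k; try by case: (csP k).
  by apply: FV; case: (csP k).
have [Fk Bk] := csP k; have [Fk1 Bk1] := csP k.+1.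
have [sub _ _] := levelP [set c' | V k.+1 c' /\
      exists c, [/\ F k c, S k c c' & B c' `<=` B c]].
have [_ [c [Fc Sc Bc]]] := sub _ Fk1.
suff <- : c = cs k by [].
have triv : trivIset (F k) B.
  have [D ->] : exists D, F k = level D by case: (k) => [|j]; eexists.
  by have [] := levelP D.
by apply: triv => //; exists f; split => //; exact: Bc.
Qed.
End banach_mazur.

(** * Coverable sets and the pruned tree of an analytic set *)

Section coverable.
Context {R : realType} {d : nat}.
Local Notation mu := (@lebesgue_measure R).
Implicit Types (A B E : set 'rV[R]_d).

Definition coverable B : Prop := exists P : set 'rV[R]_d,
  Fsigma P /\ purely_unrectifiable P /\ B `<=` P.

Lemma coverableS A B : A `<=` B -> coverable B -> coverable A.
Proof. by move=> AB [P [FP [pu BP]]]; exists P; do 2!split => //; exact: subset_trans BP. Qed.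

Lemma purely_unrectifiableS A B : A `<=` B -> purely_unrectifiable B ->
  purely_unrectifiable A.
Proof.
move=> AB pu gam lg; apply: negligibleS (pu _ lg) => t [t01 At].
by split; [exact: t01|exact: AB].
Qed.

Lemma coverable_closed E : closed E -> purely_unrectifiable E -> coverable E.
Proof.
move=> cE pu; exists E; split; last by split.
by exists (fun=> E); split => //; rewrite bigcup_const//; exists 0%N.
Qed.

Lemma coverable_bigcup (B : nat -> set 'rV[R]_d) : (forall n, coverable (B n)) ->
  coverable (\bigcup_n B n).
Proof.
move=> /choice[P PP]; exists (\bigcup_n P n); split; last split.
- have /choice[F FP] : forall n, exists F : nat -> set 'rV[R]_d,
      (forall m, closed (F m)) /\ P n = \bigcup_m F m by move=> n; case: (PP n).
  exists (fun k => if unpickle k is Some nm then F nm.1 nm.2 else set0); split.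
    by move=> k; case: unpickle => [nm|]; [exact: (FP _).1|exact: closed0].
  apply/seteqP; split => x.
    move=> [n _]; rewrite (FP n).2 => -[m _ Fx].
    by exists (pickle (n, m)); [exact: I|rewrite pickleK].
  move=> [k _]; case: unpickle => // -[n m] Fx; exists n => //.
  by rewrite (FP n).2; exists m.
- move=> gam lg; have : mu.-negligible
    (\bigcup_n [set t | t \in `[0, 1] /\ P n (gam t)]).
    by apply: negligible_bigcup => n; have [_ [pu _]] := PP n; exact: pu.
  apply: negligibleS => t [t01 [n _ Pn]]; exists n => //.
- move=> x [n _ Bx]; exists n => //; have [_ [_ BP]] := PP n; exact: BP.
Qed.

Definition nonnull E (e : 'rV[R]_d) (eps : R) : Prop :=
  exists2 gam, lipschitz_curve gam & ~ mu.-negligible (cone_times E gam e eps).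

Lemma nonnullS A B e eps : A `<=` B -> nonnull A e eps -> nonnull B e eps.
Proof.
move=> AB [gam lg nn]; exists gam => //; apply: contra_not nn.
by apply: negligibleS => t [t01 Et dt h1 h2]; split => //; exact: AB.
Qed.

Lemma nonnullW E e (eps eps' : R) : eps <= eps' -> nonnull E e eps ->
  nonnull E e eps'.
Proof.
move=> le_eps [gam lg nn]; exists gam => //; apply: contra_not nn.
apply: negligibleS => t [t01 Et dt h1 h2]; split; [exact: t01|by []..|].
by apply: (le_trans h2); rewrite ler_wpM2r// ltW.
Qed.

(** Width 2 is no restriction on the direction: [w] and [enorm w *: e] always differ by at most
    [2 * enorm w]. *)
Lemma not_purely_unrectifiable_nonnull E e : enorm e = 1 ->
  ~ purely_unrectifiable E -> nonnull E e 2.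
Proof.
move=> e1 npu.
have [gam [lg nn]] : exists gam, lipschitz_curve gam /\
    ~ mu.-negligible [set t | t \in `[0, 1] /\ E (gam t)].
  apply: contrapT => h; apply: npu => gam lg; apply: contrapT => nn.
  by apply: h; exists gam.
exists gam => // neg; apply: nn.
have [_ [c [c0 negc]]] := lg.
apply: negligibleS (negligibleU neg negc) => t [t01 Et].
have [[dt ct]|h] := pselect (derivable gam t 1 /\ c <= enorm (derive1 gam t));
  last by right; split; [exact: t01|].
left; split => //; first exact: lt_le_trans ct.
apply: (le_trans (enormB _ _)); rewrite enormZ e1 mulr1 ger0_norm ?enorm_ge0//.
by rewrite mulr_natl mulr2n.
Qed.

(** The same curve has a velocity lying in both cones, so both axes are close to its direction. *)
Lemma nonnull_refine E e (eps eps' : R) (net : seq 'rV[R]_d) :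
  (forall w, enorm w = 1 -> exists2 e, e \in net & enorm (w - e) <= eps') ->
  nonnull E e eps ->
  exists2 e', e' \in net & enorm (e - e') <= eps + eps' /\ nonnull E e' eps'.
Proof.
move=> netP [gam lg nn].
have [|e' ne' nn'] := @nonnegligible_cone R d E gam _ eps' net netP nn.
  by move=> t [t01 Et dt h1 _].
exists e' => //; split; last first.
  by exists gam => //; apply: contra_not nn'; apply: negligibleS; exact: subIsetr.
have [I0|/set0P[t [[_ _ _ w0 h1] [_ _ _ _ h2]]]] :=
    eqVneq (cone_times E gam e eps `&` cone_times E gam e' eps') set0; last first.
  set w := derive1 gam t in w0 h1 h2; rewrite -(ler_pM2l w0).
  rewrite -[X in X * _ <= _](ger0_norm (enorm_ge0 w)) -enormZ.
  rewrite [X in enorm X](_ : _ = (w - enorm w *: e') - (w - enorm w *: e)).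
    by rewrite (le_trans (enormB _ _))//; lra.
  by apply/rowP => i; rewrite !mxE; ring.
by exfalso; apply: nn'; rewrite I0; exact: negligible_set0.
Qed.
End coverable.

Section tree.
Context {R : realType} {d : nat} (g : (nat -> nat) -> 'rV[R]_d).
Hypothesis g_cont : baire_continuous g.
Implicit Types (a b : nat -> nat) (n m : nat).

Definition agree a n b : Prop := forall k, (k < n)%N -> b k = a k.

Definition big a n : Prop := ~ coverable (g @` agree a n).

Definition branch b : Prop := forall m, big b m.

(** The closure is taken so that this set, if purely unrectifiable, could serve in a cover; only
    unpruned branches enter, so that the countably many pruned cylinders account for the rest. *)
Definition portion a n : set 'rV[R]_d := closure (g @` (agree a n `&` branch)).

Lemma agree_trans a n b m c : agree a n b -> (n <= m)%N -> agree b m c ->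
  agree a n c.
Proof. by move=> ab nm bc k kn; rewrite bc ?ab// (leq_trans kn). Qed.

Lemma portionS a n b m : agree a n b -> (n <= m)%N ->
  portion b m `<=` portion a n.
Proof.
move=> ab nm; apply: closureS => _ [c [bc brc] <-]; exists c => //; split => //.
exact: agree_trans bc.
Qed.

(** The image of the cylinder lies in the portion together with the images of the countably many
    coverable cylinders, so a purely unrectifiable portion would make it coverable. *)
Lemma big_portion a n : big a n -> ~ purely_unrectifiable (portion a n).
Proof.
move=> bg pu; apply: bg.
(* Index 0 holds the portion, the others enumerate finite prefixes; the default 0 of [nth] is never
   read below [size s]. *)
pose B k := if k is j.+1 then
    if unpickle j is Some s then
      if `[< coverable (g @` agree (nth 0%N s) (size s)) >]
      then g @` agree (nth 0%N s) (size s) else set0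
    else set0
  else portion a n.
have cov0 : coverable (set0 : set 'rV[R]_d).
  apply: coverable_closed; first exact: closed0.
  by apply: (@purely_unrectifiableS _ _ _ (portion a n)).
apply: (@coverableS _ _ _ (\bigcup_k B k)); last first.
  apply: coverable_bigcup => -[|k]; rewrite /B.
    by apply: coverable_closed => //; exact: closed_closure.
  by case: unpickle => // s; case: asboolP.
move=> _ [b ab <-].
have [br|/existsNP[m /contrapT cov]] := pselect (branch b).
  by exists 0%N => //; apply: subset_closure; exists b.
have agE : agree (nth 0%N (mkseq b m)) (size (mkseq b m)) = agree b m.
  apply/seteqP; split => c h k; rewrite ?size_mkseq => km.
    by rewrite h ?size_mkseq// nth_mkseq.
  by rewrite h// nth_mkseq.
exists (pickle (mkseq b m)).+1; first exact: I.
by rewrite /B pickleK agE asboolT//; exists b.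
Qed.

Lemma portion_shrink a n p (eps : R) n0 : portion a n p -> 0 < eps ->
  exists b m, [/\ agree a n b, (n0 <= m)%N, (n <= m)%N, branch b &
    forall c, agree b m c -> enorm (g c - p) < eps].
Proof.
move=> clp eps0; have e2 : 0 < eps / 2 by rewrite divr_gt0.
have [_ [[b [ab br] <-] bp]] := closure_enorm clp e2.
have [m gm] := g_cont b e2.
exists b, (maxn m (maxn n n0)); split => //.
- by rewrite !leq_max leqnn !orbT.
- by rewrite !leq_max leqnn !orbT.
move=> c bc; have := enorm_dist (g c) (g b) p.
have : enorm (g c - g b) < eps / 2.
  by apply: gm => k km; apply: bc; rewrite leq_max km.
lra.
Qed.

Lemma portion_ball b m p (eps : R) :
  (forall c, agree b m c -> enorm (g c - p) < eps) ->
  forall x, portion b m x -> enorm (x - p) <= eps.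
Proof.
move=> h x clx; apply/ler_addgt0Pr => e e0.
have [_ [[c [bc _] <-] cx]] := closure_enorm clx e0.
have := h _ bc; have := enorm_dist x (g c) p; rewrite (enormC x (g c)); lra.
Qed.

(** All smaller big cylinders are included because later moves pass to them and must find the
    direction still available. *)
Definition hereditary a n e (eps : R) : Prop :=
  big a n /\ forall b m, agree a n b -> (n <= m)%N -> big b m ->
    nonnull (portion b m) e eps.

Lemma hereditaryS a n b m e eps : hereditary a n e eps -> agree a n b ->
  (n <= m)%N -> big b m -> hereditary b m e eps.
Proof.
move=> [_ h] ab nm bm; split => // c l bc ml bl.
by apply: h => //; [exact: agree_trans bc|exact: leq_trans ml].
Qed.

Lemma hereditaryW a n e (eps eps' : R) : eps <= eps' -> hereditary a n e eps ->
  hereditary a n e eps'.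
Proof.
by move=> le_eps [ba h]; split => // b m ab nm bm; apply: nonnullW le_eps _; exact: h.
Qed.

(** If every nearby direction of a finite net failed, one could pass to smaller big cylinders,
    killing these directions one at a time. The last cylinder would have none left, against
    [nonnull_refine]. *)
Lemma hereditary_refine a n e (eps eps' : R) : hereditary a n e eps -> 0 < eps' ->
  exists b m e', [/\ agree a n b, (n <= m)%N, enorm e' = 1,
    enorm (e - e') <= eps + eps' & hereditary b m e' eps'].
Proof.
move=> her eps'0; have [net [net1 netP]] := @unit_net R d eps' eps'0.
apply: contrapT => nex.
suff [b [m [ab nm bm nul]]] : exists b m, [/\ agree a n b, (n <= m)%N, big b m &
    forall e', e' \in net -> enorm (e - e') <= eps + eps' ->
      ~ nonnull (portion b m) e' eps'].
  have [e' e'n [ee' nn]] := nonnull_refine netP (her.2 _ _ ab nm bm).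
  exact: nul nn.
have : {subset net <= net} by [].
(* The induction runs over lists of net directions still to be killed, with the net itself kept in
   the inclusion hypothesis. *)
elim: {1 3}net => [_|e' l ih sub].
  by exists a, n; split => //; case: her.
have [|b [m [ab nm bm nul]]] := ih.
  by move=> x xl; apply: sub; rewrite inE xl orbT.
have [ee'|ee'] := leP (enorm (e - e')) (eps + eps'); last first.
  exists b, m; split => // x; rewrite inE => /predU1P[->|xl]; last exact: nul.
  by rewrite leNgt ee'.
have [her'|nher] := pselect (hereditary b m e' eps').
  exfalso; apply: nex; exists b, m, e'; split => //; apply: net1.
  by apply: sub; rewrite mem_head.
have [b' [m' [bb' mm' bm' nn]]] : exists b' m', [/\ agree b m b', (m <= m')%N,
    big b' m' & ~ nonnull (portion b' m') e' eps'].
  apply: contrapT => h; apply: nher; split => // b' m' bb' mm' bm'.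
  by apply: contrapT => nn; apply: h; exists b', m'.
exists b', m'; split => //; [exact: agree_trans bb'|exact: leq_trans mm'|].
move=> x; rewrite inE => /predU1P[-> _//|xl xe nnx].
by apply: (nul x xl xe); apply: nonnullS nnx; exact: portionS.
Qed.

Lemma big_hereditary a n e : enorm e = 1 -> big a n -> hereditary a n e 2.
Proof.
move=> e1 ban; split => // b m ab nm bm.
by apply: not_purely_unrectifiable_nonnull => //; exact: big_portion.
Qed.
End tree.

(** * Points where a function with large slope is nearly affine *)

Section slopes.
Context {R : realType} {d : nat}.
Local Notation mu := (@lebesgue_measure R).
Implicit Types (h : 'rV[R]_d -> R) (e p v : 'rV[R]_d).

(** Along the curve [h] grows at almost the maximal rate over [[a, b]], so its deficit is small and,
    by the maximal inequalities, grows slowly away from most times at all scales. Replacing the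
    curve by its tangent line then costs [eps * s]. *)
Lemma slope_point h (c : R -> 'rV[R]_d) e (q eps a b : R) (S : set R) :
  (forall x y, ucube d x -> ucube d y -> `|h x - h y| <= enorm (x - y)) ->
  enorm e = 1 -> 0 < q -> 0 < eps ->
  (forall s t, enorm (c s - c t - ((s - t) * q) *: e) <= eps * q * `|s - t|) ->
  a < b -> measurable S -> (mu (`[a, b] `\` S) <= ((b - a) / 12)%:E)%E ->
  (forall s v, a <= s <= b -> enorm v <= q * (b - a) -> ucube d (c s + v)) ->
  (1 - 2 * eps) * (q * (b - a)) <= h (c b) - h (c a) ->
  exists t, [/\ a <= t <= b, S t & forall s, 0 <= s <= q * (b - a) / 3 ->
    (1 - 41 * eps) * s <= h (c t + s *: e) - h (c t) /\
    (1 - 41 * eps) * s <= h (c t) - h (c t - s *: e)].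
Proof.
move=> hL e1 q0 eps0 cq ab mS muS dom inc.
have l0 : 0 <= b - a by rewrite subr_ge0 ltW.
have qba : 0 <= q * (b - a) by rewrite mulr_ge0// ltW.
have cdom s : a <= s <= b -> ucube d (c s).
  by move=> sab; have := dom s 0 sab; rewrite addr0 enorm0; exact.
(* Outside [[a, b]] the curve may leave the cube; clamping makes the deficit monotone and Lipschitz
   on all of [R]. *)
pose cl s := a + clamp (b - a) (s - a).
have clab s : a <= cl s <= b by have := clampP (s - a) l0; rewrite /cl; lra.
have clE s : a <= s <= b -> cl s = s.
  by move=> sab; rewrite /cl clamp_id; lra.
have cl_lip s t : s <= t -> 0 <= cl t - cl s <= t - s.
  move=> st; have st' : s - a <= t - a by rewrite lerD2r.
  by have := clamp_lip l0 st'; rewrite /cl; lra.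
have up s t : enorm (c s - c t) <= (1 + eps) * q * `|s - t|.
  have := lerB_enorm (c s - c t) (((s - t) * q) *: e).
  by rewrite enormZ e1 mulr1 normrM (gtr0_norm q0); have := cq s t; lra.
(* The deficit of [h] with respect to its maximal rate [(1 + eps) * q] along the curve; over
   [[a, b]] it increases by at most [3 * eps * q * (b - a)]. *)
pose v s := (1 + eps) * q * cl s - h (c (cl s)).
have step s t : s <= t -> 0 <= v t - v s <= 2 * (1 + eps) * q * (cl t - cl s).
  move=> st; have /andP[cst _] := cl_lip _ _ st.
  have [h1 h2] := ler_dist_split (hL _ _ (cdom _ (clab t)) (cdom _ (clab s))).
  by have := up (cl t) (cl s); rewrite ger0_norm// /v; lra.
have v_nd : {homo v : s t / s <= t}.
  by move=> s t /step /andP[]; rewrite subr_ge0.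
have L0 : 0 < 2 * (1 + eps) * q by rewrite !mulr_gt0// addr_gt0.
have vL s t : `|v s - v t| <= 2 * (1 + eps) * q * `|s - t|.
  wlog st : s t / s <= t.
    move=> H; have [/H//|/ltW/H] := leP s t.
    by rewrite distrC (distrC t).
  rewrite distrC (distrC s) (ger0_norm (x := t - s)) ?subr_ge0//.
  have /andP[h1 h2] := step _ _ st; rewrite ger0_norm//.
  apply: (le_trans h2); rewrite ler_pM2l//.
  by have /andP[] := cl_lip _ _ st.
(* With threshold [40 * eps * q] each steep set has measure at most [3 / 40 * (b - a)]. Two of them
   and the [(b - a) / 12] missing from [S] do not fill the middle third. *)
have k0 : 0 < 40 * eps * q by rewrite !mulr_gt0.
have small : (v b - v a) / (40 * eps * q) <= 3 / 40 * (b - a).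
  rewrite ler_pdivrMr// /v !clE ?lexx ?(ltW ab)//.
  rewrite [leRHS](_ : _ = 3 * eps * (q * (b - a))); last by field.
  rewrite [leLHS](_ : _ = (1 + eps) * (q * (b - a)) - (h (c b) - h (c a))); last by ring.
  lra.
have {}small : (((v b - v a) / (40 * eps * q))%:E <= (3 / 40 * (b - a))%:E)%E.
  by rewrite lee_fin.
pose phi s := v s - 40 * eps * q * s.
pose G1 := forward_minima phi a b.
pose G2 := backward_maxima phi a b.
have B1 := le_trans (measure_steep_backward k0 L0 vL (ltW ab) v_nd) small.
have B2 := le_trans (measure_steep_forward k0 L0 vL (ltW ab) v_nd) small.
rewrite -/phi -/G1 in B1; rewrite -/phi -/G2 in B2.
have phiL s t : `|phi s - phi t| <= (2 * (1 + eps) * q + 40 * eps * q) * `|s - t|.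
  rewrite [x in `|x|](_ : _ = v s - v t - 40 * eps * q * (s - t)); last first.
    by rewrite /phi; ring.
  rewrite (le_trans (ler_normB _ _))// [leRHS]mulrDl lerD//.
  by rewrite [leLHS]normrM (gtr0_norm k0).
have Lp : 0 < 2 * (1 + eps) * q + 40 * eps * q by rewrite addr_gt0.
have mG1 : measurable G1.
  by apply: closed_measurable; exact: forward_minima_closed Lp phiL.
have mG2 : measurable G2.
  by apply: closed_measurable; exact: backward_maxima_closed Lp phiL.
pose a' := a + (b - a) / 3; pose b' := b - (b - a) / 3.
have [t [tM St G1t G2t]] : exists t, [/\ a' <= t <= b', S t, G1 t & G2 t].
  apply: contrapT => nex.
  have sub : `[a', b']%classic `<=`
      (`[a, b] `\` S) `|` ((`[a, b] `\` G1) `|` (`[a, b] `\` G2)).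
    move=> t /=; rewrite !in_itv/= => tM.
    have tab : a <= t <= b by move: tM; rewrite /a' /b'; lra.
    have [St|nS] := pselect (S t); last by left.
    have [G1t|nG1] := pselect (G1 t); last by right; left.
    have [G2t|nG2] := pselect (G2 t); last by right; right.
    by exfalso; apply: nex; exists t.
  have mab : measurable (`[a, b]%classic : set R) by exact: measurable_itv.
  have mD1 := measurableD mab mS.
  have mD2 := measurableD mab mG1; have mD3 := measurableD mab mG2.
  have mD23 := measurableU _ _ mD2 mD3.
  have H1 : (mu `[a', b']%classic <= mu (`[a, b] `\` S) +
      (mu (`[a, b] `\` G1) + mu (`[a, b] `\` G2)))%E.
    apply: (@le_trans _ _ (mu ((`[a, b] `\` S) `|`
      ((`[a, b] `\` G1) `|` (`[a, b] `\` G2))))).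
      by apply: le_measure; rewrite ?inE//; exact: measurableU.
    apply: (@le_trans _ _ (mu (`[a, b] `\` S) +
      mu ((`[a, b] `\` G1) `|` (`[a, b] `\` G2)))%E).
      exact: measureU2.
    by rewrite leeD2l//; exact: measureU2.
  have H2 := le_trans H1 (leeD muS (leeD B1 B2)).
  move: H2; rewrite lebesgue_measure_itv/= lte_fin.
  have -> : a' < b' by rewrite /a' /b'; lra.
  by rewrite -EFinB -!EFinD lee_fin /a' /b'; lra.
have tab : a <= t <= b by move: tM; rewrite /a' /b'; lra.
exists t; split => // s /andP[s0 sq].
have sq' : s / q <= (b - a) / 3.
  by rewrite ler_pdivrMr// mulrC mulrA.
have sq0 : 0 <= s / q by rewrite divr_ge0// ltW.
have qs : q * (s / q) = s by rewrite mulrC divfK// gt_eqF.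
have es v' : enorm v' = 1 -> enorm (s *: v') <= q * (b - a).
  by move=> v1; rewrite enormZ v1 mulr1 ger0_norm//; lra.
have hq : s / q * q = s by rewrite divfK// gt_eqF.
have hqe : eps * q * (s / q) = eps * s by rewrite -mulrA qs.
split.
  have uab : a <= t + s / q <= b by move: tM; rewrite /a' /b'; lra.
  have [_ h2] := G2t; have := h2 (t + s / q).
  have -> : t <= t + s / q <= b by rewrite lerDl sq0/=; case/andP: uab.
  move=> /(_ isT); rewrite /phi /v !clE// => H.
  have [_ h3] := ler_dist_split (hL _ _ (dom _ _ tab (es _ e1)) (cdom _ uab)).
  have tE : t + s / q - t = s / q by ring.
  have := cq (t + s / q) t; rewrite tE ger0_norm// hq hqe.
  rewrite -enormN [X in enorm X](_ : _ = c t + s *: e - c (t + s / q)); last first.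
    by apply/rowP => i; rewrite !mxE; ring.
  move=> h4.
  have H' : (1 + eps - 40 * eps) * s <= h (c (t + s / q)) - h (c t).
    rewrite -{1}qs; lra.
  have : 0 <= eps * s by rewrite mulr_ge0// ltW.
  lra.
have uab : a <= t - s / q <= b by move: tM; rewrite /a' /b'; lra.
have [_ h2] := G1t; have := h2 (t - s / q).
have -> : a <= t - s / q <= t by rewrite gerBl sq0 andbT; case/andP: uab.
move=> /(_ isT); rewrite /phi /v !clE// => H.
have eN : enorm (- e) = 1 by rewrite enormN.
have cb := dom _ _ tab (es _ eN); rewrite scalerN in cb.
have [h3 _] := ler_dist_split (hL _ _ cb (cdom _ uab)).
have tE : t - s / q - t = - (s / q) by ring.
have := cq (t - s / q) t; rewrite tE normrN ger0_norm// hqe mulNr hq scaleNr opprK.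
rewrite -enormN [X in enorm X](_ : _ = c t - s *: e - c (t - s / q)); last first.
  by apply/rowP => i; rewrite !mxE; ring.
move=> h4.
have H' : (1 + eps - 40 * eps) * s <= h (c t) - h (c (t - s / q)).
  rewrite -{1}qs; lra.
have : 0 <= eps * s by rewrite mulr_ge0// ltW.
lra.
Qed.

Definition affine_at h p e (eps t : R) : Prop :=
  forall v, enorm v <= t -> `|h (p + v) - h p - dot e v| <= eps * t.

(** Tangency of the cone to its linearisation: with [q = |v|^2 / (2 t)], the square of the right
    side exceeds that of the left by [(dot e v + q)^2]. *)
Lemma enorm_addZ v e (t : R) : enorm e = 1 -> 0 < t -> enorm v <= t ->
  enorm (v + t *: e) <= t + dot e v + enorm v ^+ 2 / (2 * t).
Proof.
move=> e1 t0 vt.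
have := normr_dot_le_enorm e v; rewrite e1 mul1r ler_norml => /andP[h1 h2].
have v0 := enorm_ge0 v; have q0 : 0 <= enorm v ^+ 2 / (2 * t).
  by rewrite divr_ge0 ?sqr_ge0// mulr_ge0// ltW.
rewrite -(ler_pXn2r (ltn0Sn 1)) ?nnegrE ?enorm_ge0//; last by lra.
rewrite (sqr_enorm (v + _)) dotDl !dotDr !dotZl !dotZr -!sqr_enorm e1 (dotC v e).
set q := enorm v ^+ 2 / (2 * t) in q0 *.
have -> : enorm v ^+ 2 = 2 * t * q.
  by rewrite /q mulrC divfK// mulf_neq0// gt_eqF.
rewrite -subr_ge0 [leRHS](_ : _ = (dot e v + q) ^+ 2); first exact: sqr_ge0.
by ring.
Qed.

(* A 1-Lipschitz function whose slope in the unit direction e is nearly 1 on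
   both sides is squeezed between two cones that are nearly tangent to the
   affine function with gradient e. *)
Lemma slope_affine_at h p e (th R0 : R) :
  (forall x y, ucube d x -> ucube d y -> `|h x - h y| <= enorm (x - y)) ->
  enorm e = 1 -> 0 < th <= 1 ->
  (forall v, enorm v <= R0 -> ucube d (p + v)) ->
  (forall s, 0 <= s <= R0 ->
    (1 - th ^+ 2) * s <= h (p + s *: e) - h p /\
    (1 - th ^+ 2) * s <= h p - h (p - s *: e)) ->
  forall t, 0 < t <= th * R0 -> affine_at h p e (2 * th) t.
Proof.
move=> hL e1 /andP[th0 th1] dom slope t /andP[t0 tR] v vt.
(* Apexes at distance [t / th] balance the errors: the curvature of the cones costs [th * t / 2] and
   the slope defect [th ^+ 2 * s = th * t]. *)
pose s := t / th.
have s0 : 0 < s by rewrite divr_gt0.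
have sR : s <= R0 by rewrite ler_pdivrMr// mulrC.
have ts : t <= s by rewrite ler_pdivlMr// ler_piMr// ltW.
have tE : th * s = t by rewrite mulrC divfK// gt_eqF.
have /slope[sl1 sl2] : 0 <= s <= R0 by rewrite (ltW s0) sR.
have cv : ucube d (p + v) by apply: dom; rewrite (le_trans vt)// (le_trans ts).
have ce : ucube d (p + s *: e).
  by apply: dom; rewrite enormZ e1 mulr1 gtr0_norm.
have cNe : ucube d (p - s *: e).
  by apply: dom; rewrite enormN enormZ e1 mulr1 gtr0_norm.
have s20 : 0 < 2 * s by apply: mulr_gt0.
have sq : enorm v ^+ 2 / (2 * s) <= th * t / 2.
  rewrite ler_pdivrMr//.
  rewrite [leRHS](_ : _ = t * (th * s)); last by field.
  rewrite tE -expr2 ler_pXn2r ?nnegrE ?enorm_ge0//; exact: ltW.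
have up : enorm (v + s *: e) <= s + dot e v + th * t / 2.
  by apply: (le_trans (enorm_addZ e1 s0 (le_trans vt ts))); rewrite lerD2l.
have dn : enorm (- v + s *: e) <= s - dot e v + th * t / 2.
  rewrite -dotNr; apply: le_trans (enorm_addZ e1 s0 _) _; rewrite enormN.
    exact: le_trans ts.
  by rewrite lerD2l.
have [h1 _] := ler_dist_split (hL _ _ cv cNe).
have [_ h2] := ler_dist_split (hL _ _ cv ce).
rewrite [X in enorm X](_ : _ = v + s *: e) in h1; last first.
  by apply/rowP => i; rewrite !mxE; ring.
rewrite enormC [X in enorm X](_ : _ = - v + s *: e) in h2; last first.
  by apply/rowP => i; rewrite !mxE; ring.
have ths : th ^+ 2 * s = th * t by rewrite expr2 -mulrA tE.
rewrite ler_norml; have tt : 0 <= th * t by rewrite mulr_ge0// ltW.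
have sl1' : s - th * t <= h (p + s *: e) - h p by rewrite -ths; lra.
have sl2' : s - th * t <= h p - h (p - s *: e) by rewrite -ths; lra.
by lra.
Qed.

(** Clamping the affine function to the band of half-width [K] around [f] keeps the Lipschitz
    constant 1, and on the ball the band contains it. *)
Lemma affine_modification (f : 'rV[R]_d -> R) p e (K t : R) : Lip1 d f ->
  enorm e = 1 -> 0 <= K ->
  (forall v, enorm v <= t -> ucube d (p + v)) ->
  (forall v, enorm v <= t -> `|f (p + v) - f p - dot e v| <= K) ->
  exists g, [/\ Lip1 d g, forall x, ucube d x -> `|f x - g x| <= K &
    forall v, enorm v <= t -> g (p + v) = f p + dot e v].
Proof.
move=> [fL f0] e1 K0 dom fK.
pose L x := f p + dot e (x - p).
pose m x := Num.max (f x - K) (Num.min (L x) (f x + K)).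
pose g x := if `[< ucube d x >] then m x else 0.
have gE x : ucube d x -> g x = m x by move=> cx; rewrite /g asboolT.
have LL x y : `|L x - L y| <= enorm (x - y).
  rewrite /L [X in `|X|](_ : _ = dot e (x - y)).
    by have := normr_dot_le_enorm e (x - y); rewrite e1 mul1r.
  by rewrite !dotBr; ring.
have mL x y : ucube d x -> ucube d y -> m x <= m y + enorm (x - y).
  move=> cx cy; have [a1 _] := ler_dist_split (fL _ _ cx cy).
  have [b1 _] := ler_dist_split (LL x y).
  rewrite /m ge_max; apply/andP; split.
    have : f y - K <= Num.max (f y - K) (Num.min (L y) (f y + K)).
      by rewrite le_max lexx.
    lra.
  have : Num.min (L y) (f y + K) <= Num.max (f y - K) (Num.min (L y) (f y + K)).
    by rewrite le_max lexx orbT.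
  suff : Num.min (L x) (f x + K) <= Num.min (L y) (f y + K) + enorm (x - y) by lra.
  rewrite -lerBlDr le_min; apply/andP; split; rewrite lerBlDr ge_min; apply/orP.
    by left; lra.
  by right; lra.
exists g; split.
- split; last by move=> x cx; rewrite /g asboolF.
  move=> x y cx cy; rewrite !gE// ler_norml.
  by have := mL _ _ cx cy; have := mL _ _ cy cx; rewrite (enormC y); lra.
- move=> x cx; rewrite gE// /m.
  rewrite ler_norml.
  by have [|] := leP (L x) (f x + K); have [|] := leP (f x - K); lra.
- move=> v vt; rewrite gE; last exact: dom.
  have := fK _ vt; rewrite ler_norml => H.
  have LE : L (p + v) = f p + dot e v by rewrite /L addrAC subrr add0r.
  rewrite /m LE (min_idPl _); last by lra.
  by rewrite (max_idPr _)//; lra.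
Qed.
End slopes.

(** * The winning strategy *)

Section strategy.
Context {R : realType} {d : nat} (g : (nat -> nat) -> 'rV[R]_d).
Hypothesis g_cont : baire_continuous g.
Local Notation mu := (@lebesgue_measure R).
Local Notation fn := ('rV[R]_d -> R).

(* A state of the Banach-Mazur game in which [O] is the current open set. *)
Definition position (eps : R) (O : set fn) a n (e : 'rV[R]_d) (tau : R) : Prop :=
  [/\ enorm e = 1, 0 < tau, hereditary g a n e eps,
      forall h, O h -> Lip1 d h /\ exists2 p, portion g a n p &
        forall t, 0 < t <= tau -> affine_at h p e eps t &
      forall p v, portion g a n p -> enorm v <= tau -> ucube d (p + v)].

Lemma closed_preimage_curve (E : set 'rV[R]_d) (c : R -> 'rV[R]_d) (L : R) :
  0 < L -> closed E -> (forall s t, enorm (c s - c t) <= L * `|s - t|) ->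
  closed [set t | t \in `[0, 1] /\ E (c t)].
Proof.
move=> L0 cE cL t clt.
have near_pt eps : 0 < eps -> exists t', [/\ t' \in `[0, 1], E (c t') & `|t - t'| < eps].
  move=> eps0; have [|t' [[t'01 Et'] tt']] := clt (ball t eps).
    exact: nbhsx_ballx.
  by exists t'.
split.
  rewrite in_itv/=; apply/andP; split; apply/ler_addgt0Pr => eps eps0;
    have [t' [+ _]] := near_pt _ eps0; rewrite in_itv/= ltr_norml; lra.
apply: closed_enorm => // eps eps0.
have [t' [_ Et' tt']] := near_pt _ (divr_gt0 eps0 L0).
exists (c t'); split => //; apply: (le_lt_trans (cL _ _)).
by rewrite distrC mulrC -ltr_pdivlMr.
Qed.

Lemma affine_at_tilt (f : fn) p e e' (eps eps1 t : R) : enorm (e - e') <= eps1 ->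
  affine_at f p e eps t -> affine_at f p e' (eps + eps1) t.
Proof.
move=> ee' fp v vt; have := fp _ vt.
have t0 : 0 <= t by rewrite (le_trans _ vt)// enorm_ge0.
have : `|dot (e - e') v| <= eps1 * t.
  rewrite (le_trans (normr_dot_le_enorm _ _))//.
  by apply: ler_pM => //; exact: enorm_ge0.
rewrite dotBl !ler_norml mulrDl; lra.
Qed.

Lemma affine_curve_point (E : set 'rV[R]_d) (f : fn) p e (y eps t0 : R) :
  0 < eps <= 1 -> 0 < t0 -> enorm e = 1 -> closed E ->
  (forall x, E x -> enorm (x - p) <= t0 / 4) ->
  (forall v, enorm v <= t0 -> ucube d (p + v) /\ f (p + v) = y + dot e v) ->
  nonnull E e ((eps / 2) ^+ 2 / 41 / (3 * (d%:R + 1))) ->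
  exists del tau, [/\ 0 < del, 0 < tau <= t0 / 16 &
    forall h, sup_ball f del h -> exists2 x, E x &
      forall t, 0 < t <= tau -> affine_at h x e eps t].
Proof.
move=> /andP[eps0 eps1] t00 e1 cE Ep fp [gam lg nn].
have dd : 0 < d%:R + 1 :> R by rewrite ltr_wpDl.
(* The slope loss [41 * ec] of [slope_point] becomes [th ^+ 2], which [slope_affine_at] turns into
   the error [2 * th = eps]. *)
pose th := eps / 2; pose ec := th ^+ 2 / 41.
have th0 : 0 < th by rewrite divr_gt0.
have th1 : th <= 1 by rewrite /th; lra.
have ec0 : 0 < ec by rewrite divr_gt0// exprn_gt0.
have ec1 : ec <= 1 by rewrite /ec; nra.
pose k := ec / (3 * (d%:R + 1)).
have k0 : 0 < k by rewrite divr_gt0// mulr_gt0.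
have [q [c [q0 cq' nS]]] := cone_curve e1 k0 nn.
have cq s t : enorm (c s - c t - ((s - t) * q) *: e) <= ec * q * `|s - t|.
  apply: (le_trans (cq' s t)).
  have -> : ec = (d%:R + 1) * (3 * k).
    by rewrite /k; field; rewrite gt_eqF.
  rewrite -!mulrA ler_wpM2r ?lerDl//.
  by rewrite !mulr_ge0// ltW.
have cL s t : enorm (c s - c t) <= 2 * q * `|s - t|.
  have := lerB_enorm (c s - c t) (((s - t) * q) *: e).
  rewrite enormZ e1 mulr1 normrM (gtr0_norm q0); have := cq s t.
  have : ec * (q * `|s - t|) <= 1 * (q * `|s - t|).
    by rewrite ler_wpM2r ?mulr_ge0 ?(ltW q0).
  lra.
have q20 : 0 < 2 * q by rewrite mulr_gt0.
pose S := [set t | t \in `[0, 1] /\ E (c t)].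
have cS : closed S by exact: closed_preimage_curve q20 cE cL.
have mS : measurable S by exact: closed_measurable.
(* With [q * l <= t0 / 16] the piece of curve stays within [3 / 8 * t0] of [p], and translates by at
   most [q * (b - a)] remain in the affine ball. *)
have sig0 : 0 < t0 / (16 * q) by rewrite divr_gt0// mulr_gt0.
have eta0 : 0 < 12^-1 :> R by rewrite invr_gt0.
have [x0 [l [Sx0 /andP[l0 lsig] dens]]] := density_interval mS nS eta0 sig0.
pose a := x0 - l; pose b := x0 + l.
have ba : b - a = 2 * l by rewrite /a /b; ring.
have ql : q * l <= t0 / 16.
  move: lsig; rewrite ltr_pdivlMr ?mulr_gt0// => H; lra.
have ql0 : 0 < q * l by rewrite mulr_gt0.
have cnear s : a <= s <= b -> enorm (c s - p) <= 3 / 8 * t0.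
  move=> sab; have := enorm_dist (c s) (c x0) p; have := Ep _ Sx0.2.
  have := cL s x0; have : 2 * q * `|s - x0| <= 2 * q * l.
    by rewrite ler_wpM2l ?(ltW q20)// ler_norml; move: sab; rewrite /a /b; lra.
  lra.
have cdom s v : a <= s <= b -> enorm v <= q * (b - a) -> ucube d (c s + v).
  move=> sab vq; rewrite -(subrKC p (c s)) -addrA; apply: (fp _ _).1.
  have := enormD (c s - p) v; have := cnear _ sab; move: vq; rewrite ba; lra.
pose R0 := q * (b - a) / 3.
have R0E : R0 = 2 / 3 * (q * l) by rewrite /R0 ba; field.
have R00 : 0 < R0 by rewrite R0E mulr_gt0// divr_gt0.
have tauR : th * R0 <= R0 by rewrite ler_piMl// ltW.
have a1 : a <= a <= b by rewrite /a /b; lra.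
have b1 : a <= b <= b by rewrite /a /b; lra.
have cE' s : a <= s <= b -> ucube d (c s) /\ f (c s) = y + dot e (c s - p).
  move=> sab; rewrite -{1 2}(subrKC p (c s)); apply: fp.
  by have := cnear _ sab; lra.
have inc : (1 - ec) * (q * (b - a)) <= dot e (c b - c a).
  have := normr_dot_le_enorm e (c b - c a - ((b - a) * q) *: e).
  rewrite e1 mul1r (dotBr (c b - c a)) dotZr -sqr_enorm e1 expr1n mulr1.
  have := cq b a; rewrite ger0_norm; last by rewrite ba; lra.
  by rewrite ler_norml (mulrC q); lra.
(* Errors [ec * (q * l)] at both ends add up to [ec * (q * (b - a))], which spoils the growth
   [1 - ec] of [f] along the curve only to [1 - 2 * ec]. *)
exists (ec * (q * l)), (th * R0); split.
- exact: mulr_gt0.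
- by rewrite mulr_gt0//=; lra.
move=> h [hL [r' [rr' hr']]].
have [| | |t [tab [_ Et] slopes]] := @slope_point R d h c e q ec a b S hL.1
    e1 q0 ec0 cq _ mS _ cdom.
- by rewrite /a /b; lra.
- by apply: (le_trans dens); rewrite lee_fin ba; lra.
- have [ca fa] := cE' _ a1; have [cb fb] := cE' _ b1.
  have := hr' _ ca; have := hr' _ cb; move: inc.
  rewrite fa fb !dotBr !ler_norml ba; lra.
exists (c t) => // s /andP[s0 ss].
have -> : eps = 2 * th by rewrite /th; field.
apply: (@slope_affine_at R d h (c t) e th R0 hL.1 e1) => //.
- by rewrite th0.
- move=> v vR; apply: cdom => //; apply: (le_trans vR).
  by rewrite R0E ba; lra.
- move=> u uR; have := slopes _ uR.
  by have -> : 41 * ec = th ^+ 2 by rewrite /ec; field.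
- by rewrite s0.
Qed.

(** Below [t0 / 2] the modified [g'] is exactly affine near [x], with gradient close to [e]. Above,
    [x] is close to [p] relative to [t], and comparing with [f] at scale [2 * t] costs [4 * eps],
    the modification [8 * eps + 4 * eps1], and [h] at most [eps']. *)
Lemma affine_transition (f g' h : fn) p x e e' (eps eps1 eps' t0 t tau del : R) :
  0 < eps -> 0 < eps1 <= eps' -> enorm (e - e') <= eps + eps1 ->
  0 < t <= tau / 2 -> 0 < t0 -> enorm (x - p) <= t0 / 4 ->
  (forall v, enorm v <= t -> ucube d (x + v)) ->
  (forall t, 0 < t <= tau -> affine_at f p e eps t) ->
  (forall z, ucube d z -> `|f z - g' z| <= (eps + (eps + eps1)) * t0) ->
  (forall v, enorm v <= t0 -> g' (p + v) = f p + dot e' v) ->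
  (forall z, ucube d z -> `|g' z - h z| <= del) -> 2 * del <= eps' * t ->
  affine_at h x e (12 * eps + 5 * eps') t.
Proof.
move=> eps0 /andP[eps10 eps1'] ee' /andP[t_gt0 ttau] t00 xp dom fp g'f g'p close delt v vt.
have cx : ucube d x by rewrite -[x]addr0; apply: dom; rewrite enorm0 ltW.
have cxv : ucube d (x + v) by exact: dom.
have h1 := close _ cx; have h2 := close _ cxv.
have uE : x + v = p + (x - p + v) by rewrite addrA subrKC.
have xE : x = p + (x - p) by rewrite subrKC.
have un := enormD (x - p) v.
have et : 0 <= eps * t by rewrite mulr_ge0// ltW.
have e't : eps1 * t <= eps' * t by rewrite ler_wpM2r// ltW.
have e1t : 0 <= eps1 * t by rewrite mulr_ge0// ltW.
have [tt0|t0t] := leP t (t0 / 2).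
  have g1 : g' (x + v) = f p + dot e' (x - p + v) by rewrite uE; apply: g'p; lra.
  have g2 : g' x = f p + dot e' (x - p) by rewrite {1}xE; apply: g'p; lra.
  have : `|dot (e - e') v| <= (eps + eps1) * t.
    rewrite (le_trans (normr_dot_le_enorm _ _))//.
    by apply: ler_pM => //; exact: enorm_ge0.
  move: h1 h2; rewrite g1 g2 dotBl (dotDr (x - p)) !ler_norml; lra.
have t2 : 0 < 2 * t <= tau by lra.
have f1 : `|f (x + v) - f p - dot e (x - p + v)| <= eps * (2 * t).
  by rewrite uE; apply: fp => //; lra.
have f2 : `|f x - f p - dot e (x - p)| <= eps * (2 * t).
  by rewrite {1}xE; apply: fp => //; lra.
have := g'f _ cx; have := g'f _ cxv.
have : eps * t0 <= eps * (2 * t) by rewrite ler_wpM2l ?(ltW eps0)//; lra.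
have : eps1 * t0 <= eps1 * (2 * t) by rewrite ler_wpM2l ?(ltW eps10)//; lra.
move: f1 f2 h1 h2; rewrite (dotDr (x - p)) !ler_norml; lra.
Qed.

Lemma position_step (eps eps' : R) O a n e tau (f : fn) r :
  0 < eps <= 2 -> 0 < eps' <= 1 -> position eps O a n e tau ->
  Lip1 d f -> 0 < r -> sup_ball f r `<=` O ->
  exists g' del b m e' tau', [/\ Lip1 d g' /\ 0 < del,
    sup_ball g' del `<=` sup_ball f r,
    position eps' (sup_ball g' del) b m e' tau',
    [/\ agree a n b, (n < m)%N, enorm (e - e') <= eps + eps' & tau' <= tau / 2] &
    forall h x t, sup_ball g' del h -> portion g b m x ->
      tau' / 2 <= t <= tau / 2 -> affine_at h x e (12 * eps + 5 * eps') t].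
Proof.
move=> /andP[eps0 eps2] /andP[eps'0 eps'1] [e1 tau0 her Oh dom] fL r0 subO.
have ff : sup_ball f r f.
  by split => //; exists 0; split => // x _; rewrite subrr normr0.
have [_ [p pE fp]] := Oh _ (subO _ ff).
have dd : 0 < d%:R + 1 :> R by rewrite ltr_wpDl.
pose ec := (eps' / 2) ^+ 2 / 41; pose eps1 := ec / (3 * (d%:R + 1)).
have ec0 : 0 < ec by rewrite divr_gt0// exprn_gt0// divr_gt0.
have ec1 : ec <= eps' by rewrite /ec; nra.
have d3 : 0 < 3 * (d%:R + 1) :> R by rewrite mulr_gt0.
have eps10 : 0 < eps1 by rewrite divr_gt0.
have eps1' : eps1 <= eps'.
  apply: le_trans ec1; rewrite ler_pdivrMr// ler_peMr ?(ltW ec0)//.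
  by have := ler0n R d; lra.
(* As [eps <= 2] and [eps1 <= 1], the modification moves [f] by at most [5 * t0], hence by at most
   [r / 4]. *)
have [t0 [t00 t0tau t0r]] : exists t0, [/\ 0 < t0, t0 <= tau / 2 & t0 <= r / 20].
  by exists (Num.min (tau / 2) (r / 20)); rewrite lt_min !ge_min !lexx orbT !divr_gt0.
have t04 : 0 < t0 / 4 by rewrite divr_gt0.
(* Localising near [p] comes before refining the direction, since refinement only shrinks the
   cylinder and so keeps it near [p]. *)
have [b0 [m0 [ab0 nm0 nm0' br0 gb0]]] := portion_shrink g_cont n.+1 pE t04.
have her0 := hereditaryS her ab0 nm0' (br0 m0).
have [b [m [e' [ab' nm' e'1 ee' her']]]] := hereditary_refine her0 eps10.
have ab : agree a n b by exact: agree_trans ab0 nm0' ab'.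
have nm : (n < m)%N by exact: leq_trans nm0 nm'.
have subE : portion g b m `<=` portion g a n := portionS ab (ltnW nm).
have ballE x : portion g b m x -> enorm (x - p) <= t0 / 4.
  by move=> /(portionS ab' nm'); exact: portion_ball gb0 x.
have t0t : t0 <= tau by lra.
have fp' : affine_at f p e' (eps + (eps + eps1)) t0.
  by apply: affine_at_tilt ee' _; apply: fp; rewrite t00.
pose K := (eps + (eps + eps1)) * t0.
have K0 : 0 <= K by rewrite mulr_ge0// ltW// !addr_gt0.
have Kr : K <= r / 4.
  have : (eps + (eps + eps1)) * t0 <= 5 * t0 by rewrite ler_wpM2r ?(ltW t00)//; lra.
  rewrite /K; lra.
have domp v : enorm v <= t0 -> ucube d (p + v).
  by move=> vt; apply: dom => //; exact: le_trans t0t.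
have [g' [g'L g'f g'p]] := affine_modification fL e'1 K0 domp fp'.
have nn := her'.2 b m (fun _ _ => erefl) (leqnn m) her'.1.
have [|||del0 [tau' [del00 /andP[tau'0 tau't] hdel]]] := @affine_curve_point
    (portion g b m) g' p e' (f p) eps' t0 _ t00 e'1 _ ballE _ nn.
- by rewrite eps'0.
- exact: closed_closure.
- by move=> v vt; split; [exact: domp|exact: g'p].
have [del [del_gt0 delr deld delt]] : exists del,
    [/\ 0 < del, del <= r / 4, del <= del0 & del <= eps' * tau' / 4].
  exists (Num.min (r / 4) (Num.min del0 (eps' * tau' / 4))).
  rewrite !lt_min !ge_min !lexx !orbT del00 !divr_gt0// mulr_gt0//.
have close h x : sup_ball g' del h -> ucube d x -> `|g' x - h x| <= del.
  by move=> [_ [r' [rr' hr']]] cx; apply: (le_trans (hr' _ cx)); exact: ltW.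
exists g', del, b, m, e', tau'; split => //.
- move=> h hb; have [hL _] := hb; split => //; exists (r / 2); split; first by lra.
  move=> x cx; have := g'f _ cx; have := close _ _ hb cx.
  rewrite !ler_norml; lra.
- split => //; first exact: hereditaryW her'.
  + move=> h hb; have [hL _] := hb; split => //.
    apply: hdel; split => //; have [_ [r' [rr' hr']]] := hb.
    by exists r'; split => //; exact: lt_le_trans deld.
  + move=> x v xE vt; apply: dom; first exact: subE.
    by apply: (le_trans vt); lra.
- by split => //; [move: ee'; lra|lra].
move=> h x t hb xE /andP[tt' ttau].
have t_gt0 : 0 < t by apply: lt_le_trans tt'; rewrite divr_gt0.
apply: (affine_transition (eps1 := eps1) (tau := tau) eps0 _ ee' _ t00
  (ballE _ xE) _ fp g'f g'p (close h ^~ hb)).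
- by rewrite eps10.
- by rewrite t_gt0.
- by move=> v vt; apply: dom; [exact: subE|rewrite (le_trans vt)// (le_trans ttau)//; lra].
have : eps' * tau' <= eps' * (2 * t) by rewrite ler_wpM2l ?(ltW eps'0)//; lra.
lra.
Qed.

(** With tolerance 2 the affine condition is automatic: a 1-Lipschitz function and a linear one with
    unit gradient both vary by at most [t]. Any unit vector can start the game. *)
Lemma position_root : (1 <= d)%N -> range g `<=` open_cube d ->
  ~ coverable (range g) -> exists a n e tau, forall f r, Lip1 d f -> 0 < r ->
    position 2 (sup_ball f r) a n e tau.
Proof.
move=> d1 gcube ncov.
have big0 : big g (fun=> 0%N) 0.
  by apply: contra_not ncov; apply: coverableS => _ [b _ <-]; exists b.
have [b0 br0] : exists b, branch g b.
  apply: contrapT => nb; apply: (big_portion big0) => gam lg.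
  apply: negligibleS (negligible_set0 _) => t [_].
  move=> /closure_enorm/(_ 1 ltr01)[_ [[b [_ br] _] _]].
  by apply: nb; exists b.
have [rho rho0 hrho] : exists2 rho : R, 0 < rho & forall v, enorm v <= rho ->
    ucube d (g b0 + v).
  have : nbhs (g b0) (@open_cube R d).
    have /choice[rh rhP] : forall i, exists rh : R, 0 < rh /\
        forall y, `|y - g b0 ord0 i| < rh -> 0 < y < 1.
      move=> i; have /andP[x0 x1] : 0 < g b0 ord0 i < 1 by apply: gcube; exists b0.
      exists (Num.min (g b0 ord0 i) (1 - g b0 ord0 i)); split.
        by rewrite lt_min x0 subr_gt0.
      by move=> y; rewrite lt_min !ltr_norml => /andP[]; lra.
    apply/nbhs_enormP; exists (\big[Num.min/1]_i rh i).
      by apply/bigmin_gtP; split => // i _; exact: (rhP i).1.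
    move=> y yx i; apply: (rhP i).2.
    have := normr_coord_le_enorm (y - g b0) i; rewrite !mxE => /le_lt_trans; apply.
    by apply: (lt_le_trans yx); exact: bigmin_le.
  move=> /nbhs_enormP[rh rh0 h]; exists (rh / 2); first by rewrite divr_gt0.
  move=> v vr i; have /h/(_ i) : enorm (g b0 + v - g b0) < rh.
    by rewrite addrAC subrr add0r; lra.
  by lra.
have r20 : 0 < rho / 2 by rewrite divr_gt0.
have [m gm] := g_cont b0 r20.
pose e : 'rV[R]_d := \row_i (i == Ordinal d1)%:R.
have e1 : enorm e = 1 by exact: enorm_basis.
exists b0, m, e, (rho / 2) => f r fL r0.
have pball : forall x, portion g b0 m x -> enorm (x - g b0) <= rho / 2.
  by apply: portion_ball => c bc; exact: gm.
have dom p v : portion g b0 m p -> enorm v <= rho / 2 -> ucube d (p + v).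
  move=> /pball pb vr; rewrite -(subrKC (g b0) p) -addrA; apply: hrho.
  by apply: (le_trans (enormD _ _)); lra.
split => //.
- exact: big_hereditary.
- move=> h [hL _]; split => //; exists (g b0).
    by apply: subset_closure; exists b0.
  move=> t /andP[t0 tr] v vt.
  have pE : portion g b0 m (g b0) by apply: subset_closure; exists b0.
  have cv : ucube d (g b0 + v) by apply: dom => //; lra.
  have c0 : ucube d (g b0) by rewrite -[g b0]addr0; apply: dom; rewrite // enorm0; lra.
  have := hL.1 _ _ cv c0; rewrite addrAC subrr add0r.
  have := normr_dot_le_enorm e v; rewrite e1 mul1r !ler_norml; lra.
Qed.
End strategy.

(** * Runs of the game and differentiability of the limit function *)

Section game.
Context {R : realType} {d : nat} (g : (nat -> nat) -> 'rV[R]_d).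
Hypothesis g_cont : baire_continuous g.
Local Notation fn := ('rV[R]_d -> R).
Implicit Types (k m : nat).

(** It starts at 2, the only tolerance available at the root, and halves so that the changes of
    direction are summable. *)
Definition tolerance k : R := 2 / 2 ^+ k.

Lemma tolerance_gt0 k : 0 < tolerance k.
Proof. by rewrite divr_gt0// exprn_gt0. Qed.

Lemma toleranceS k : tolerance k.+1 = tolerance k / 2.
Proof. by rewrite /tolerance exprS invfM mulrA mulrAC. Qed.

Lemma tolerance_le k m : (k <= m)%N -> tolerance m <= tolerance k.
Proof.
move=> /subnKC <-; elim: (m - k)%N => [|j ih]; rewrite ?addn0// addnS toleranceS.
by have := tolerance_gt0 (k + j); lra.
Qed.

Lemma tolerance_lt (c y : R) : 0 < c -> 0 < y -> exists k, c * tolerance k < y.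
Proof.
move=> c0 y0; have z0 : 0 <= c * 2 / y by rewrite ltW// divr_gt0// mulr_gt0.
exists (Num.bound (c * 2 / y)); rewrite /tolerance mulrA ltr_pdivrMr ?exprn_gt0//.
rewrite [ltRHS]mulrC -ltr_pdivrMr//; apply: (lt_trans (archi_boundP z0)).
by rewrite -natrX ltr_nat ltn_expl.
Qed.

Lemma run_differentiable (f : fn) (a : nat -> nat -> nat) (n : nat -> nat)
    (e : nat -> 'rV[R]_d) (tau : nat -> R) :
  (forall k, big g (a k) (n k)) -> (forall k, agree (a k) (n k) (a k.+1)) ->
  (forall k, (n k < n k.+1)%N) ->
  (forall k, enorm (e k - e k.+1) <= tolerance k + tolerance k.+1) ->
  (forall k, 0 < tau k) -> (forall k, tau k.+1 <= tau k / 2) ->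
  (forall k x t, portion g (a k.+1) (n k.+1) x -> tau k.+1 / 2 <= t <= tau k / 2 ->
     affine_at f x (e k) (12 * tolerance k + 5 * tolerance k.+1) t) ->
  exists x, range g x /\ differentiable f x.
Proof.
move=> bigk agk nS eS tau0 tauS aff.
have nk k : (k <= n k)%N by elim: k => // k ih; exact: leq_ltn_trans (nS k).
have agm k m : (k <= m)%N -> (n k <= n m)%N /\ agree (a k) (n k) (a m).
  move=> /subnKC <-; elim: (m - k)%N => [|j [ih1 ih2]]; rewrite ?addn0// addnS.
  by split; [exact: leq_trans (ltnW (nS _))|exact: agree_trans (agk _)].
(* Depths satisfy [k <= n k], so entry [i] is already settled at stage [i + 1]. *)
pose al i := a i.+1 i.
have agal k : agree (a k) (n k) al.
  move=> i ik; rewrite /al; have [ki|/ltnW ki] := leqP k i.+1.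
    by have [_ ->] := agm _ _ ki.
  by have [_ ->] := agm _ _ ki; last exact: nk.
have bral : branch g al.
  move=> m; apply: contra_not (bigk m); apply: coverableS => _ [b ab <-].
  exists b => // i im; rewrite ab ?(leq_trans im)//.
  by rewrite (agal m)// (leq_trans im).
have xE k : portion g (a k) (n k) (g al) by apply: subset_closure; exists al.
(* Consecutive directions differ by at most [3 / 2 * tolerance k], which is
   [3 * (tolerance k - tolerance k.+1)] and telescopes. *)
have ekm k m : (k <= m)%N -> enorm (e k - e m) <= 3 * tolerance k.
  move=> km; suff : enorm (e k - e m) <= 3 * (tolerance k - tolerance m).
    by have := tolerance_gt0 m; lra.
  rewrite -(subnKC km); elim: (m - k)%N => [|j ih].
    by rewrite addn0 subrr enorm0 subrr mulr0.
  rewrite addnS; have := enorm_dist (e k) (e (k + j)%N) (e (k + j).+1).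
  by have := eS (k + j)%N; rewrite toleranceS; lra.
have /choice[l lP] : forall i, exists l, forall k,
    `|e k ord0 i - l| <= 3 * tolerance k.
  move=> i; apply: nested_limit => k m.
  have [km|/ltnW km] := leqP k m.
    have := normr_coord_le_enorm (e k - e m) i; rewrite !mxE ler_norml.
    by have := ekm _ _ km; have := tolerance_gt0 m; lra.
  have := normr_coord_le_enorm (e m - e k) i; rewrite !mxE ler_norml.
  by have := ekm _ _ km; have := tolerance_gt0 k; lra.
pose el : 'rV[R]_d := \row_i l i.
have ell k : enorm (e k - el) <= d%:R * (3 * tolerance k).
  apply: enorm_le_coord => [i|]; first by rewrite !mxE.
  by rewrite mulr_ge0// ltW// tolerance_gt0.
have tau_le k m : (k <= m)%N -> tau m <= tau k.
  move=> /subnKC <-; elim: (m - k)%N => [|j ih]; rewrite ?addn0// addnS.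
  by have := tauS (k + j)%N; have := tau0 (k + j)%N; lra.
have tau_tol k : tau k <= tau 0%N * tolerance k.
  elim: k => [|k ih]; first by rewrite /tolerance expr0; have := tau0 0%N; lra.
  by rewrite toleranceS; have := tauS k; lra.
exists (g al); split; first by exists al.
apply: (differentiable_enorm (e := el)) => eps eps0.
(* [12 + 5 / 2] comes from the affine estimate between stages and [3 * d] from replacing [e k] by
   the limit direction. *)
have c0 : 0 < 15 + 3 * d%:R :> R by rewrite ltr_pwDl// mulr_ge0.
have [K KP] := tolerance_lt c0 eps0.
exists (tau K / 2) => [|v vK]; first by rewrite divr_gt0.
have [v0|v0] := leP (enorm v) 0.
  have /eqP : enorm v = 0 by apply/eqP; rewrite eq_le v0 enorm_ge0.
  rewrite enorm_eq0 => /eqP ->.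
  have -> : dot el 0 = 0 by rewrite -(subrr el) dotBr subrr.
  by rewrite addr0 subrr subrr normr0 enorm0 mulr0.
(* The least such [m] is [k + 1] for the stage [k] whose range of scales contains [enorm v]. *)
have exm : exists m, tau m / 2 < enorm v.
  have [m mP] := tolerance_lt (tau0 0%N) v0.
  by exists m; have := tau_tol m; have := tau0 m; lra.
case: (ex_minnP exm) => m mv mmin.
have Km : (K < m)%N.
  by rewrite ltnNge; apply/negP => mK; have := tau_le _ _ mK; lra.
case: m Km mv mmin => // k Kk kv kmin.
have kv' : enorm v <= tau k / 2.
  by rewrite leNgt; apply/negP => /kmin; rewrite ltnn.
have vk : tau k.+1 / 2 <= enorm v <= tau k / 2 by rewrite (ltW kv).
have := affine_at_tilt (ell k) (aff k _ _ (xE _) vk) (lexx _).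
move=> /le_trans; apply; rewrite ler_wpM2r ?enorm_ge0// toleranceS.
apply: le_trans (ltW KP).
have tk : tolerance k <= tolerance K by exact: tolerance_le.
have d0 : d%:R * tolerance k <= d%:R * tolerance K :> R by rewrite ler_wpM2l.
have := tolerance_gt0 k; rewrite mulrDl; lra.
Qed.

Record stage := Stage { center : fn; radius : R; address : nat -> nat;
  depth : nat; direction : 'rV[R]_d; scale : R }.

Definition stage_ball (c : stage) := sup_ball (center c) (radius c).

Definition valid_stage k (c : stage) := [/\ Lip1 d (center c), 0 < radius c & position g (tolerance k)
  (stage_ball c) (address c) (depth c) (direction c) (scale c)].

Definition stage_step k (c c' : stage) :=
  [/\ agree (address c) (depth c) (address c'), (depth c < depth c')%N,
    enorm (direction c - direction c') <= tolerance k + tolerance k.+1,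
    scale c' <= scale c / 2 &
    forall h x t, stage_ball c' h -> portion g (address c') (depth c') x ->
      scale c' / 2 <= t <= scale c / 2 ->
      affine_at h x (direction c) (12 * tolerance k + 5 * tolerance k.+1) t].

Lemma not_coverable_residual : (1 <= d)%N -> range g `<=` open_cube d ->
  ~ coverable (range g) ->
  residual_Lip1 [set f : fn | Lip1 d f /\ exists x, range g x /\ differentiable f x].
Proof.
move=> d1 gcube ncov.
apply: (@banach_mazur R d stage stage_ball valid_stage stage_step).
- by move=> k c [cL r0 _]; exists (center c), (radius c).
- move=> f r fL r0.
  have [a [n [e [tau pos]]]] := position_root g_cont d1 gcube ncov.
  exists (Stage f r a n e tau) => //; split => //=.
  by have := pos f r fL r0; rewrite /tolerance expr0 divr1.
- move=> k c f r [cL rc0 pos] fL r0 sub.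
  have tk : 0 < tolerance k <= 2.
    rewrite tolerance_gt0 (le_trans (tolerance_le (leq0n k)))//.
    by rewrite /tolerance expr0 divr1.
  have tk' : 0 < tolerance k.+1 <= 1 by rewrite toleranceS; lra.
  have [f' [del [b [m [e' [tau' [[f'L del0] sub' pos' [h1 h2 h3 h4] h5]]]]]]] :=
    position_step g_cont tk tk' pos fL r0 sub.
  by exists (Stage f' del b m e' tau'); split.
move=> f cs fL csV csS csB; split => //.
apply: (@run_differentiable f (address \o cs) (depth \o cs) (direction \o cs)
  (scale \o cs)) => k /=.
- by have [_ _ [_ _ her _ _]] := csV k; exact: her.1.
- by have [] := csS k.
- by have [] := csS k.
- by have [] := csS k.
- by have [_ _ [_ t0 _ _]] := csV k.
- by have [] := csS k.
- by have [_ _ _ _ h] := csS k; move=> x t; exact: h.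
Qed.
End game.

(** * The equivalence for analytic sets *)

Theorem theorem2p1 (R : realType) (d : nat) (A : set 'rV[R]_d) :
  (1 <= d)%N -> A `<=` open_cube d -> analytic A ->
  ((~ exists P : set 'rV[R]_d,
        Fsigma P /\ purely_unrectifiable P /\ A `<=` P)
   <->
   residual_Lip1
     [set f : 'rV[R]_d -> R | Lip1 d f /\
        exists x, A x /\ differentiable f x]).
Proof.
move=> d1 Acube anA; split; last exact: residual_not_coverable.
case: anA => [->|[g [g_cont AE]]] ncov; last first.
  by rewrite AE in Acube ncov *; exact: not_coverable_residual.
exfalso; apply: ncov; apply: coverable_closed; first exact: closed0.
by move=> gam _; apply: negligibleS (negligible_set0 _) => t [].
Qed.
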